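(* The function $K\mapsto\tau_K$ is strictly decreasing on $[1,\infty)$, while $K\mapsto M_K$ is strictly increasing on $[1,\infty)$. Moreover, $$M_1=1,\qquad 1<M_K<\min\left\{\frac{2K}{K+1},\frac4\pi\right\}\quad(K>1),\qquad \lim_{K\to\infty}M_K=\frac4\pi .$$
   Context: Let $H$ be a real Hilbert space with $\dim H\ge2$ and $\mathbb B_H=\{x\in H:|x|<1\}$; $\mathbb D$ is the open unit disk in $\mathbb C$. A $C^2$ map $F:\mathbb D\to H$ is harmonic if $\Delta F=0$. $L_F(0)=\max_{|v|=1}|dF_0v|$, $\ell_F(0)=\min_{|v|=1}|dF_0v|$. For $K\ge1$, $M_K$ is the supremum of $L_F(0)$ over all harmonic maps $F:\mathbb D\to\mathbb B_H$ with $F(0)=0$ and $0<\ell_F(0)\le L_F(0)\le K\ell_F(0)$. For $K\ge1$, $\tau_K$ denotes the unique minimizer over $\tau\in(0,1]$ of $$\frac{2J(\tau)}{1+\tau/K},\qquad J(\tau)=\frac1{2\pi}\int_0^{2\pi}\sqrt{\cos^2t+\tau^2\sin^2t}\,dt$$ (existence and uniqueness are known; $\tau_1=1$ and, for $K>1$, $\tau_K\in(0,1)$; the infimum equals $M_K$. Equivalently, for $K>1$, $\tau_K$ is the unique solution in $(0,1)$ of $\alpha(\tau)/\beta(\tau)=K$, with $\alpha(\tau)=\frac1\pi\int_0^{2\pi}\frac{\cos^2t}{\sqrt{\cos^2t+\tau^2\sin^2t}}dt$ and $\beta(\tau)=\frac1\pi\int_0^{2\pi}\frac{\tau\sin^2t}{\sqrt{\cos^2t+\tau^2\sin^2t}}dt$;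 and $M_K=\alpha(\tau_K)$ for all $K\ge1$). *)

(* Defs.v *)
From HB Require Import structures.
From mathcomp Require Import all_boot all_order all_algebra.
From mathcomp Require Import all_classical all_reals all_analysis.
Import Order.TTheory GRing.Theory Num.Theory.
Import numFieldNormedType.Exports.

Set Implicit Arguments.
Unset Strict Implicit.
Unset Printing Implicit Defensive.

Local Open Scope classical_set_scope.
Local Open Scope ring_scope.

(* The complex plane is identified with [R * R], the point (x, y) being x + iy.
   The library's norm on [R * R] is the max norm, so the Euclidean disk and
   circle are written out; the topology, hence differentiability and
   differentials, do not depend on this choice of norm. *)
Definition unit_disk (R : realType) : set (R * R) :=
  [set p | p.1 ^+ 2 + p.2 ^+ 2 < 1].

Definition unit_circle (R : realType) : set (R * R) :=
  [set p | p.1 ^+ 2 + p.2 ^+ 2 = 1].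

(* As the source has finite dimension, continuity of the differential in
   operator norm is continuity of every directional derivative. *)
Definition C1_on (R : realType) (H : normedModType R)
    (A : set (R * R)) (F : R * R -> H) : Prop :=
  forall p, A p ->
    differentiable F p /\ forall v, {for p, continuous ('D_v F)}.

Definition C2_on (R : realType) (H : normedModType R)
    (A : set (R * R)) (F : R * R -> H) : Prop :=
  C1_on A F /\ forall v, C1_on A ('D_v F).

Definition laplacian (R : realType) (H : normedModType R)
    (F : R * R -> H) : R * R -> H :=
  fun p => 'D_(1, 0) ('D_(1, 0) F) p + 'D_(0, 1) ('D_(0, 1) F) p.

(* A map on the disk is represented by a function on the whole plane, of which
   only the values in the disk matter. *)
Definition harmonic_on_disk (R : realType) (H : normedModType R)
    (F : R * R -> H) : Prop :=
  C2_on (@unit_disk R) F /\ forall p, unit_disk p -> laplacian F p = 0.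

(* L_F(0) and l_F(0): for F differentiable at 0 the extrema are attained, by
   compactness of the circle, so that sup and inf are max and min. *)
Definition max_stretch (R : realType) (H : normedModType R)
    (F : R * R -> H) : R :=
  sup [set `|'d F (0, 0) v| | v in @unit_circle R].

Definition min_stretch (R : realType) (H : normedModType R)
    (F : R * R -> H) : R :=
  inf [set `|'d F (0, 0) v| | v in @unit_circle R].

Definition admissible (R : realType) (H : normedModType R) (K : R)
    (F : R * R -> H) : Prop :=
  [/\ harmonic_on_disk F,
      (forall p, unit_disk p -> `|F p| < 1),
      F (0, 0) = 0 &
      0 < min_stretch F /\
      min_stretch F <= max_stretch F <= K * min_stretch F].

(* The junk value of [sup] on an empty or unbounded set is 0, so that any claim
   [1 <= M H K] includes that the supremum is a genuine one. *)
Definition M (R : realType) (H : normedModType R) (K : R) : R :=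
  sup [set max_stretch F | F in [set F : R * R -> H | admissible K F]].

Definition J (R : realType) (t : R) : R :=
  (2 * pi)^-1 *
  \int[@lebesgue_measure R]_(x in `[0, 2 * pi])
     Num.sqrt (cos x ^+ 2 + t ^+ 2 * sin x ^+ 2).

Definition tau_objective (R : realType) (K t : R) : R :=
  2 * J t / (1 + t / K).

Definition unique_minimizer (R : realType) (K t : R) : Prop :=
  0 < t <= 1 /\
  forall s : R, 0 < s <= 1 -> s != t -> tau_objective K t < tau_objective K s.

(* The choice operator picks the unique minimizer; were there none, its value
   would be the default point 0, outside (0, 1]. *)
Definition tau (R : realType) (K : R) : R :=
  xget 0 [set t | unique_minimizer K t].

(* Main.v *)
Require Import Defs.
From HB Require Import structures.
From mathcomp Require Import all_boot all_order all_algebra.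
From mathcomp Require Import all_classical all_reals all_analysis.
From mathcomp Require Import ring lra.
Import Order.TTheory GRing.Theory Num.Theory.
Import numFieldNormedType.Exports.

Local Open Scope classical_set_scope.
Local Open Scope ring_scope.

(** The theorem rests on an upper and a lower bound for [M H K], and on
    the convexity of J.

    Upper bound. Let F be admissible and let v, w be an orthonormal frame of
    the plane for which A v and A w are orthogonal, A being the differential
    at 0; then |A v| and |A w| are the largest and the smallest stretch. Let
    e, f be the directions of A v and A w. The first Fourier coefficients of a
    harmonic function on a circle of radius r are r times its differential at
    0, so that pairing F with cos x *: e + t sin x *: f on that circle gives
    pi r (|A v| + t |A w|). As |F| < 1, this is at most the integral of
    sqrt (cos^2 + t^2 sin^2), which is 2 pi J t. Letting r tend to 1 and using
    |A w| >= |A v| / K gives max_stretch F <= tau_objective K t for every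
    t >= 0 ([max_stretch_le]). Small t yields M < 4 / pi, because J has slope 0
    at 0 ([J_slope0]) and J 0 = 2 / pi; t = 1 / K yields M < 2K / (K + 1),
    because J is at most a root mean square ([J_le_rms]); t = 1 yields
    M H 1 <= 1.

    Lower bound. The harmonic function (2 / pi) atan (2 xi / (1 - |z|^2)), xi
    being a linear coordinate, maps the disk into ]-1, 1[ and has differential
    4 / pi times xi at 0. A convex combination of an admissible F and of this
    function, placed along the direction A v / |A v|, keeps A v and A w
    orthogonal; it is admissible for a larger K and has a larger stretch
    ([boost]). Applied to an isometric embedding of the plane, it gives
    M H K >= (4 / pi) K / (K - 1 + 4 / pi) ([M_lower_bound]), hence M H 1 >= 1,
    M H K > 1 for K > 1, and the limit. Applied to every F admissible for K1,
    it gives M H K1 < M H K2, by the strict inequality M H K2 < 4 / pi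
    ([M_increasing]).

    For tau, strict convexity of J gives at most one minimizer of J t / (K + t)
    on [0, 1], and the slope 0 at 0 excludes t = 0. Comparing the optimality of
    tau K1 at tau K2 with the optimality of tau K2 at tau K1 gives
    tau K2 <= tau K1. A common minimizer t < 1 would give the convex function
    J two supporting lines at t, of slopes J t / (K1 + t) and J t / (K2 + t),
    against the bound h^2 / t on its second differences. *)

(** * Continuity of composite functions *)

Section Continuity.
Context {R : realType} {T : topologicalType}.
Implicit Types f g : T -> R.

Lemma contD f g : continuous f -> continuous g -> continuous (fun x => f x + g x).
Proof. by move=> cf cg x; apply: continuousD; [exact: cf|exact: cg]. Qed.

Lemma contM f g : continuous f -> continuous g -> continuous (fun x => f x * g x).
Proof. by move=> cf cg x; apply: continuousM; [exact: cf|exact: cg]. Qed.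

Lemma contN f : continuous f -> continuous (fun x => - f x).
Proof. by move=> cf x; apply: continuousN; exact: cf. Qed.

Lemma contX f n : continuous f -> continuous (fun x => f x ^+ n).
Proof.
move=> cf; elim: n => [|n IHn]; first exact: cst_continuous.
by under eq_fun do rewrite exprS; exact: contM.
Qed.

Lemma contC (h : R -> R) f : continuous h -> continuous f ->
  continuous (fun x => h (f x)).
Proof. by move=> ch cf x; apply: continuous_comp; [exact: cf|exact: ch]. Qed.

Lemma contK (c : R) : continuous (fun _ : T => c).
Proof. exact: cst_continuous. Qed.

End Continuity.

Lemma contI {T : topologicalType} : continuous (fun x : T => x).
Proof. by move=> x; exact: cvg_id. Qed.

Ltac cont :=
  lazymatch goal with
  | |- continuous (fun _ => ?c) => exact: contK
  | |- continuous (fun x => x) => exact: contI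
  | |- continuous (fun x => _ + _) => apply: contD; cont
  | |- continuous (fun x => _ * _) => apply: contM; cont
  | |- continuous (fun x => - _) => apply: contN; cont
  | |- continuous (fun x => _ ^+ _) => apply: contX; cont
  | |- continuous (fun x => sin _) =>
      apply: (contC sin); [exact: continuous_sin | cont]
  | |- continuous (fun x => cos _) =>
      apply: (contC cos); [exact: continuous_cos | cont]
  | |- continuous (fun x => Num.sqrt _) =>
      apply: (contC Num.sqrt); [exact: sqrt_continuous | cont]
  | |- continuous (fun x => `|_|) =>
      apply: (contC Num.norm); [exact: norm_continuous | cont]
  | |- continuous sin => exact: continuous_sin
  | |- continuous cos => exact: continuous_cos
  | |- _ => first [assumption | idtac]
  end.

(** * Integrals over a period *)

Section CircleIntegral.
Context {R : realType}.
Notation mu := (@lebesgue_measure R).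

Definition circ (f : R -> R) : R := \int[mu]_(x in `[0, 2 * pi]) f x.

Lemma twopi_gt0 : 0 < 2 * pi :> R.
Proof. by rewrite mulr_gt0 // pi_gt0. Qed.

Lemma circ_integrable (f : R -> R) :
  continuous f -> mu.-integrable `[0, 2 * pi] (EFin \o f).
Proof.
move=> cf; apply: continuous_compact_integrable; first exact: segment_compact.
exact: continuous_subspaceT.
Qed.

Lemma eq_circ (f g : R -> R) : f =1 g -> circ f = circ g.
Proof. by move=> fg; apply: eq_Rintegral => x _. Qed.

Lemma circD (f g : R -> R) : continuous f -> continuous g ->
  circ (fun x => f x + g x) = circ f + circ g.
Proof. by move=> cf cg; rewrite /circ RintegralD //; exact: circ_integrable. Qed.

Lemma circZ (a : R) (f : R -> R) : continuous f ->
  circ (fun x => a * f x) = a * circ f.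
Proof. by move=> cf; rewrite /circ RintegralZl //; exact: circ_integrable. Qed.

Lemma le_circ (f g : R -> R) : continuous f -> continuous g ->
  (forall x, f x <= g x) -> circ f <= circ g.
Proof. by move=> cf cg fg; apply: le_Rintegral => //; exact: circ_integrable. Qed.

Lemma circ_FTC (F f : R -> R) : continuous f ->
  (forall x : R, is_derive x (1 : R) F (f x)) -> circ f = F (2 * pi) - F 0.
Proof.
move=> cf dF.
have cF : continuous F.
  move=> x; apply: differentiable_continuous.
  by apply/derivable1_diffP; have [] := dF x.
rewrite /circ /Rintegral (@continuous_FTC2 R f F) ?twopi_gt0 //.
- exact: continuous_subspaceT.
- split; first by move=> x _; have [] := dF x.
  + exact/cvg_at_right_filter/cF.
  + exact/cvg_at_left_filter/cF.
- by move=> x _; rewrite derive1E; have [] := dF x.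
Qed.

Lemma circ_cst (c : R) : circ (fun=> c) = 2 * pi * c.
Proof.
have dF x : is_derive (x : R) (1 : R) (fun x => x * c) c.
  by apply: is_derive_eq; rewrite /= scaler0 add0r /GRing.scale /= mulr1.
rewrite (circ_FTC _ _ (@cst_continuous _ _ c) dF); ring.
Qed.

Lemma continuous_sin2 : continuous (fun x : R => sin x ^+ 2).
Proof. by cont. Qed.

Lemma circ_sin2 : circ (fun x => sin x ^+ 2) = pi :> R.
Proof.
have dF x : is_derive (x : R) (1 : R)
    (fun x => 2^-1 * (x - sin x * cos x)) (sin x ^+ 2).
  apply: is_derive_eq; rewrite /= /GRing.scale /=.
  have := cos2Dsin2 x; set c := cos x; set s := sin x => h.
  lra.
rewrite (circ_FTC _ _ continuous_sin2 dF).
rewrite -[2 * pi]/(2%:R * pi) mulr_natl sin2pi sin0 -mulr_natl.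
by field.
Qed.

End CircleIntegral.

(** * The mean J t of the ellipse integrand *)

Section EllipseIntegrand.
Context {R : realType}.
Implicit Types t u h x : R.

(** The Euclidean norm of (cos x, t sin x), a point of the ellipse of semiaxes
    1 and t. *)
Definition ell t x : R := Num.sqrt (cos x ^+ 2 + t ^+ 2 * sin x ^+ 2).

Lemma ell_cont t : continuous (ell t).
Proof. by rewrite /ell; cont. Qed.

Lemma JE t : J t = (2 * pi)^-1 * circ (ell t).
Proof. by []. Qed.

Lemma circ_ell t : circ (ell t) = 2 * pi * J t.
Proof. by rewrite JE mulVKf // gt_eqF // twopi_gt0. Qed.

Lemma ell_ge0 t x : 0 <= ell t x.
Proof. exact: sqrtr_ge0. Qed.

Lemma sqr_ell t x : ell t x ^+ 2 = cos x ^+ 2 + t ^+ 2 * sin x ^+ 2.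
Proof.
rewrite sqr_sqrtr //; apply: addr_ge0; first exact: sqr_ge0.
by apply: mulr_ge0; exact: sqr_ge0.
Qed.

Lemma ell1 x : ell 1 x = 1.
Proof. by rewrite /ell expr1n mul1r cos2Dsin2 sqrtr1. Qed.

Lemma J1 : J 1 = 1 :> R.
Proof.
rewrite JE (eq_circ _ _ ell1) circ_cst mulr1 mulVf // gt_eqF //.
exact: twopi_gt0.
Qed.

Lemma ell0 x : ell 0 x = `|cos x|.
Proof. by rewrite /ell expr0n /= mul0r addr0 sqrtr_sqr. Qed.

Lemma le_J t (c : R) (f : R -> R) : continuous f -> (forall x, ell t x <= c * f x) ->
  J t <= (2 * pi)^-1 * (c * circ f).
Proof.
move=> cf le; rewrite JE ler_pM2l ?invr_gt0 ?twopi_gt0 // -circZ //.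
by apply: le_circ => //; [exact: ell_cont|cont].
Qed.

Lemma J_ge0 t : 0 <= J t.
Proof.
rewrite JE mulr_ge0 //; first by rewrite invr_ge0 ltW // twopi_gt0.
rewrite -(mulr0 (2 * pi)) -circ_cst.
by apply: le_circ; [cont|exact: ell_cont|exact: ell_ge0].
Qed.

(** By the inequality between the arithmetic and geometric means,
    ell t x <= (m + ell t x ^+ 2 / m) / 2, with m the quadratic mean of
    [ell t], so that integration returns m. *)
Lemma J_le_rms t : J t <= Num.sqrt ((1 + t ^+ 2) / 2).
Proof.
set m := Num.sqrt _.
have m2 : m ^+ 2 = (1 + t ^+ 2) / 2.
  by rewrite sqr_sqrtr // divr_ge0 // addr_ge0 // sqr_ge0.
have m_gt0 : 0 < m.
  by rewrite sqrtr_gt0 divr_gt0 // ltr_wpDr ?sqr_ge0.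
have le x : ell t x <= (2 * m)^-1 * ((m ^+ 2 + 1) + (t ^+ 2 - 1) * sin x ^+ 2).
  rewrite ler_pdivlMl ?mulr_gt0 //.
  have := sqr_ell t x; have := cos2Dsin2 x; have := sqr_ge0 (ell t x - m).
  set e := ell t x; set c := cos x; set s := sin x; set q := s ^+ 2.
  by rewrite sqrrB => h1 h2 h3; nra.
apply: le_trans (le_J _ _ _ _ le) _; first by cont.
rewrite circD; [|by cont|by cont].
rewrite circ_cst circZ; last exact: continuous_sin2.
rewrite circ_sin2 le_eqVlt; apply/orP; left; apply/eqP.
have pi0 := lt0r_neq0 (@pi_gt0 R); have m0 := lt0r_neq0 m_gt0.
have -> : 2 * pi * (m ^+ 2 + 1) + (t ^+ 2 - 1) * pi = 4 * pi * m ^+ 2.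
  by rewrite m2; field.
by move: (@pi R) pi0 => p p0; field; rewrite m0 p0.
Qed.

Lemma ell_lip t u x : ell t x <= ell u x + `|t - u|.
Proof.
have e := sqr_ell t x; have f := sqr_ell u x.
have t0 := ell_ge0 t x; have u0 := ell_ge0 u x.
have cs := cos2Dsin2 x.
have d0 := normr_ge0 (t - u).
have d2 : `|t - u| ^+ 2 = (t - u) ^+ 2 by rewrite real_normK ?num_real.
have d1 := ler_norm (u * (t - u)).
rewrite normrM in d1.
have us : `|u| * `|sin x| <= ell u x.
  by rewrite -normrM -sqrtr_sqr ler_wsqrtr // exprMn lerDr sqr_ge0.
have s1 : `|sin x| <= 1 by rewrite ler_norml sin_geN1 sin_le1.
have s2 : `|sin x| ^+ 2 = sin x ^+ 2 by rewrite real_normK ?num_real.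
rewrite -ler_sqr ?nnegrE ?addr_ge0 //.
rewrite e sqrrD f d2.
set s := sin x in us s1 s2 cs e f *; set c := cos x in cs e f *.
have h1 : u * (t - u) * s ^+ 2 <= ell u x * `|t - u|.
  apply: le_trans (_ : `|u| * `|t - u| * `|s| ^+ 2 <= _).
    by rewrite s2 ler_wpM2r ?sqr_ge0.
  have := normr_ge0 s; have := normr_ge0 u.
  rewrite mulrAC expr2 mulrA => n1 n2.
  rewrite ler_wpM2r //.
  apply: le_trans us; rewrite ler_piMr // mulr_ge0 //.
have h2 : (t - u) ^+ 2 * s ^+ 2 <= (t - u) ^+ 2.
  by rewrite ler_piMr ?sqr_ge0 // -cs lerDr sqr_ge0.
nra.
Qed.

Lemma J_lip t u : `|J t - J u| <= `|t - u|.
Proof.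
wlog le : t u / J u <= J t.
  move=> W; have [|/ltW] := leP (J u) (J t); first exact: W.
  by rewrite (distrC t) (distrC (J t)); exact: W.
rewrite ger0_norm ?subr_ge0 // lerBlDl.
have h : circ (ell t) <= circ (fun x => ell u x + `|t - u|).
  by apply: le_circ; [exact: ell_cont|apply: contD; [exact: ell_cont|cont]|
                      move=> x; exact: ell_lip].
move: h; rewrite circD; [|exact: ell_cont|exact: contK].
by rewrite circ_cst !circ_ell -mulrDr ler_pM2l // twopi_gt0.
Qed.

Lemma J_cont : continuous (@J R).
Proof.
move=> t; apply/cvgrPdist_le => e e0.
near=> u; apply: le_trans (J_lip t u) _.
near: u; exact: cvgr_dist_le.
Unshelve. all: by end_near. Qed.

End EllipseIntegrand.

Section EllipsePerimeter.
Context {R : realType}.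
Implicit Types t u h x : R.
Notation mu := (@lebesgue_measure R).

Lemma ell_gt0 t x : 0 < t -> 0 < ell t x.
Proof.
move=> t0; rewrite sqrtr_gt0.
have := cos2Dsin2 x; have := sqr_ge0 (cos x); have := sqr_ge0 (sin x).
have : 0 < t ^+ 2 by rewrite exprn_gt0.
set a := cos x ^+ 2; set b := sin x ^+ 2; set c := t ^+ 2 => *.
by have [?|?] := ltP 0 a; nra.
Qed.

Lemma ell_le1 t x : 0 <= t <= 1 -> ell t x <= 1.
Proof.
move=> /andP[t0 t1]; rewrite -(ler_sqr (ell_ge0 _ _)) ?nnegrE // sqr_ell expr1n.
have := cos2Dsin2 x; have := sqr_ge0 (sin x).
have : t ^+ 2 <= 1 by rewrite expr_le1.
by set a := cos x ^+ 2; set b := sin x ^+ 2; set c := t ^+ 2 => *; nra.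
Qed.

Lemma circ_sin2cos2 : circ (fun x => sin x ^+ 2 * cos x ^+ 2) = pi / 4 :> R.
Proof.
have dF x : is_derive (x : R) (1 : R)
    (fun x => 8^-1 * (x - sin x * cos x * (cos x ^+ 2 - sin x ^+ 2)))
    (sin x ^+ 2 * cos x ^+ 2).
  apply: is_derive_eq; rewrite /= /GRing.scale /=.
  have := cos2Dsin2 x; set c := cos x; set s := sin x => h.
  have -> : s ^+ 2 = 1 - c ^+ 2 by rewrite -h; ring.
  have e : s * s = 1 - c ^+ 2 by rewrite -h; ring.
  have e2 : s * s * s * s = (1 - c ^+ 2) ^+ 2 by rewrite -e; ring.
  have : 8^-1 * 8 = 1 :> R by rewrite mulVf.
  move: (8^-1 : R) => k hk; nra.
rewrite (circ_FTC _ _ _ dF); last by cont.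
rewrite -[2 * pi]/(2%:R * pi) mulr_natl sin2pi sin0 -mulr_natl.
by rewrite !mul0r !subr0 mulr0 subr0; move: (@pi R) => p; field.
Qed.

(** Writing A, B for the two values on the right and m for the one on the left,
    (A + B)^2 - (2m)^2 = 2 (A B - Y) with Y = cos^2 + t u sin^2, and
    (A B)^2 - Y^2 = cos^2 sin^2 (t - u)^2; all the quantities divided by are
    bounded since t and u lie in [0, 1]. This gap, unlike the bare convexity of
    the integrand, survives integration. *)
Lemma ell_midpoint t u x : 0 <= t <= 1 -> 0 <= u <= 1 ->
  2 * ell ((t + u) / 2) x + (t - u) ^+ 2 / 4 * (sin x ^+ 2 * cos x ^+ 2)
  <= ell t x + ell u x.
Proof.
move=> t01 u01.
have m01 : 0 <= (t + u) / 2 <= 1.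
  by move: t01 u01 => /andP[? ?] /andP[? ?]; apply/andP; split; lra.
have := ell_le1 t x t01; have := ell_le1 u x u01; have := ell_le1 _ x m01.
have := sqr_ell t x; have := sqr_ell u x; have := sqr_ell ((t + u) / 2) x.
have := ell_ge0 t x; have := ell_ge0 u x; have := ell_ge0 ((t + u) / 2) x.
have := cos2Dsin2 x; have := sqr_ge0 (cos x); have := sqr_ge0 (sin x).
set p := cos x ^+ 2; set q := sin x ^+ 2.
set A := ell t x; set B := ell u x; set m := ell _ x.
move: t01 u01 => /andP[t0 t1] /andP[u0 u1].
move=> q0 p0 pq m0 B0 A0 m2 B2 A2 m1 B1 A1.
set Y := p + t * u * q; set Z := p * q * (t - u) ^+ 2.
have tu0 : 0 <= t * u by rewrite mulr_ge0.
have tu1 : t * u <= 1 by rewrite -[1]mulr1 ler_pM.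
have Y0 : 0 <= Y by rewrite addr_ge0 // mulr_ge0.
have Y1 : Y <= 1 by rewrite /Y; nra.
have X0 : 0 <= A * B by rewrite mulr_ge0.
have X1 : A * B <= 1 by rewrite -[1]mulr1 ler_pM.
have Z0 : 0 <= Z by apply: mulr_ge0; [exact: mulr_ge0|exact: sqr_ge0].
have XY : (A * B) ^+ 2 - Y ^+ 2 = Z by rewrite exprMn A2 B2 /Y /Z; ring.
have XY0 : Y <= A * B by rewrite -ler_sqr ?nnegrE //; lra.
have XYZ : Z <= 2 * (A * B - Y).
  have -> : Z = (A * B + Y) * (A * B - Y) by rewrite -XY; ring.
  by rewrite ler_wpM2r ?subr_ge0 //; lra.
have E : (A + B) ^+ 2 - (2 * m) ^+ 2 = 2 * (A * B - Y).
  by rewrite sqrrD exprMn A2 B2 m2 /Y; field.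
have AB0 : 2 * m <= A + B.
  by rewrite -ler_sqr ?nnegrE ?addr_ge0 ?mulr_ge0 //; lra.
have : Z <= 4 * (A + B - 2 * m).
  apply: (le_trans XYZ); rewrite -E.
  have -> : (A + B) ^+ 2 - (2 * m) ^+ 2 = (A + B + 2 * m) * (A + B - 2 * m).
    by ring.
  by rewrite ler_wpM2r ?subr_ge0 //; lra.
have -> : (t - u) ^+ 2 / 4 * (q * p) = Z / 4 by rewrite /Z; field.
lra.
Qed.

Lemma J_strictly_convex t u : 0 <= t <= 1 -> 0 <= u <= 1 -> t != u ->
  2 * J ((t + u) / 2) < J t + J u.
Proof.
move=> t01 u01 tu.
have cs2 : continuous (fun x : R => sin x ^+ 2 * cos x ^+ 2) by cont.
have ct v : continuous (ell v : R -> R) := ell_cont v.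
have := le_circ _ _ _ _ (fun x => ell_midpoint t u x t01 u01).
rewrite !circD ?circZ ?circ_sin2cos2 ?circ_ell; try by cont.
have := @twopi_gt0 R; have -> : pi / 4 = 2 * pi / 8 :> R.
  by move: (@pi R) => p; field.
move: (2 * pi) => c c0 /(_ _ _) h.
have {h} : c * (2 * J ((t + u) / 2) + (t - u) ^+ 2 / 32) <= c * (J t + J u).
  apply: le_trans (le_trans (h _ _) _); try by cont.
    by rewrite le_eqVlt; apply/orP; left; apply/eqP; field.
  by rewrite mulrDr.
rewrite ler_pM2l // => h; apply: lt_le_trans h.
by rewrite ltrDl divr_gt0 // lt0r sqr_ge0 sqrf_eq0 subr_eq0 tu.
Qed.

(** The square root is concave, so as a function of u^2 the integrand lies below
    its tangent at t^2. *)
Lemma ell_tangent t u x : 0 < t ->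
  ell u x <= ell t x + (u ^+ 2 - t ^+ 2) * (sin x ^+ 2 / (2 * ell t x)).
Proof.
move=> t0; have e0 := ell_gt0 t x t0.
have := sqr_ell t x; have := sqr_ell u x; have := sqr_ge0 (ell u x - ell t x).
move: (ell t x) (ell u x) (sin x) (cos x) e0 => e f a b e0; rewrite sqrrB => h1 h2 h3.
have -> : e + (u ^+ 2 - t ^+ 2) * (a ^+ 2 / (2 * e))
          = (2 * e ^+ 2 + (u ^+ 2 - t ^+ 2) * a ^+ 2) / (2 * e).
  by field; rewrite gt_eqF.
rewrite ler_pdivlMr ?mulr_gt0 //; lra.
Qed.

(** A substitute for the differentiability of J on ]0, +oo[: it excludes a
    corner of the graph. *)
Lemma J_second_difference t h : 0 < t -> J (t + h) + J (t - h) <= 2 * J t + h ^+ 2 / t.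
Proof.
move=> t0; have ct v : continuous (ell v : R -> R) := ell_cont v.
suff : circ (fun x => ell (t + h) x + ell (t - h) x) <=
       circ (fun x => 2 * ell t x + h ^+ 2 / t).
  rewrite !circD ?circZ ?circ_ell ?circ_cst; try by cont.
  have := @twopi_gt0 R; move: (2 * pi) => c c0.
  by move=> H; rewrite -(ler_pM2l c0) !mulrDr; lra.
apply: le_circ; [by cont|by cont|].
move=> x; have e0 := ell_gt0 t x t0.
have h1 := ell_tangent t (t + h) x t0.
have h2 := ell_tangent t (t - h) x t0.
have h3 : sin x ^+ 2 / (2 * ell t x) <= (2 * t)^-1.
  rewrite ler_pdivrMr ?mulr_gt0 // ler_pdivlMl ?mulr_gt0 //.
  have : t * sin x ^+ 2 <= ell t x.
    have s1 : sin x ^+ 2 <= 1 by rewrite -(cos2Dsin2 x) lerDr sqr_ge0.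
    have s0 := sqr_ge0 (sin x).
    suff H : (t * sin x ^+ 2) ^+ 2 <= ell t x ^+ 2.
      by rewrite -ler_sqr // nnegrE; [apply: mulr_ge0; rewrite // ltW|exact: ltW].
    rewrite sqr_ell exprMn.
    have := sqr_ge0 (cos x); have := sqr_ge0 t.
    move: s0 s1; set q := sin x ^+ 2; set p := cos x ^+ 2 => *.
    have : q ^+ 2 <= q by rewrite expr2 ler_piMl.
    by move=> *; nra.
  by move=> ?; lra.
have h4 : 0 <= h ^+ 2 := sqr_ge0 h.
have -> : h ^+ 2 / t = 2 * h ^+ 2 * (2 * t)^-1 by field; rewrite gt_eqF.
move: h1 h2 h3; set y := _ / (2 * ell t x) => h1 h2 h3.
have : 2 * h ^+ 2 * y <= 2 * h ^+ 2 * (2 * t)^-1 by apply: ler_wpM2l => //; exact: mulr_ge0.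
move: h1 h2; rewrite !sqrrD sqrrN => *; lra.
Qed.

Lemma Rintegral_itv_split (f : R -> R) a b c : continuous f -> a <= b -> b <= c ->
  \int[mu]_(x in `[a, c]) f x
  = \int[mu]_(x in `[a, b]) f x + \int[mu]_(x in `[b, c]) f x.
Proof.
move=> cf ab bc.
have ci u v : mu.-integrable `[u, v] (EFin \o f).
  apply: continuous_compact_integrable; first exact: segment_compact.
  exact: continuous_subspaceT.
rewrite -[\int[mu]_(x in `[b, c]) f x]Rintegral_itv_obnd_cbnd; last first.
  by apply: integrableS (ci b c) => //; exact: subset_itv_oc_cc.
rewrite -(@Rintegral_itvB _ f (BLeft a) (BRight c) b) //.
by rewrite addrC subrK.
Qed.

Lemma Rintegral_abs_cos (k a b : R) : a < b ->
  (forall x, x \in `[a, b] -> `|cos x| = k * cos x) ->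
  \int[mu]_(x in `[a, b]) `|cos x| = k * (sin b - sin a).
Proof.
move=> ab h.
have ck : continuous (fun x : R => k * cos x) by cont.
have cs : continuous (fun x : R => k * sin x) by cont.
rewrite (@eq_Rintegral _ _ _ mu _ (fun x => k * cos x)); last first.
  by move=> x; rewrite inE => /h.
rewrite /Rintegral (@continuous_FTC2 R _ (fun x => k * sin x)) //=.
- by rewrite mulrBr.
- exact: continuous_subspaceT.
- split; first by move=> x _; exact: derivableM.
  + exact/cvg_at_right_filter/cs.
  + exact/cvg_at_left_filter/cs.
- move=> x _; rewrite derive1E.
  have -> : 'D_1 (fun x : R => k * sin x) x = k * cos x; last by [].
  have d : is_derive (x : R) (1 : R) (fun x => k * sin x) (k * cos x).
    by apply: is_derive_eq; rewrite /GRing.scale /=; ring.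
  by have [] := d.
Qed.

Lemma circ_abs_cos : circ (fun x => `|cos x|) = 4 :> R.
Proof.
have p0 := @pi_gt0 R.
have c1 : continuous (fun x : R => `|cos x|) by cont.
rewrite /circ (Rintegral_itv_split _ _ (pi / 2)) //; [|lra|lra].
rewrite (Rintegral_itv_split _ (pi / 2) (pi + pi / 2)) //; [|lra|lra].
rewrite (Rintegral_abs_cos 1); [|lra|]; last first.
  move=> x; rewrite in_itv /= => /andP[h1 h2].
  rewrite mul1r ger0_norm //.
  by apply: cos_ge0_pihalf; apply/andP; split; lra.
rewrite (Rintegral_abs_cos (- 1)); [|lra|]; last first.
  move=> x; rewrite in_itv /= => /andP[h1 h2].
  rewrite mulN1r ler0_norm // -[x](subrK pi) cosDpi oppr_le0.
  by apply: cos_ge0_pihalf; apply/andP; split; lra.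
rewrite (Rintegral_abs_cos 1); [|lra|]; last first.
  move=> x; rewrite in_itv /= => /andP[h1 h2].
  rewrite mul1r ger0_norm // -[x](subrK (pi *+ 2)) cosD2pi.
  by apply: cos_ge0_pihalf; rewrite -(mulr_natl pi 2); apply/andP; split; lra.
rewrite (addrC pi) sinDpi sin_pihalf sin0.
rewrite -[2 * pi]/(2%:R * pi) mulr_natl sin2pi; lra.
Qed.

Lemma J0 : J 0 = 2 / pi :> R.
Proof.
rewrite JE (eq_circ _ _ ell0) circ_abs_cos.
by have := lt0r_neq0 (@pi_gt0 R); move: (@pi R) => p p0; field.
Qed.

End EllipsePerimeter.

(** * The slope of J at 0 *)

Section SlopeAtZero.
Context {R : realType}.
Implicit Types t x e : R.

Definition wallis n : R := circ (fun x => sin x ^+ (2 * n)).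

(** The derivative of sin^(2n+1) cos has integral 0 over a period. *)
Lemma wallis_rec n : (2 * n + 2)%:R * wallis n.+1 = (2 * n + 1)%:R * wallis n.
Proof.
have cs k : continuous (fun x : R => sin x ^+ k) by cont.
have c0 (k : R) m : continuous (fun x : R => k * sin x ^+ m) by cont.
have dF x : is_derive (x : R) (1 : R) (fun x => sin x ^+ (2 * n).+1 * cos x)
    ((2 * n + 1)%:R * sin x ^+ (2 * n)
     + (- (2 * n + 2)%:R) * sin x ^+ (2 * n).+2).
  have dS : is_derive x (1 : R) (fun x => sin x ^+ (2 * n).+1)
      ((2 * n).+1%:R * sin x ^+ (2 * n) * cos x).
    rewrite (_ : (fun x => _) = (sin : R -> R) ^+ (2 * n).+1).
      by apply: is_derive_eq.
    by apply/funext => y; rewrite exprfctE.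
  apply: is_derive_eq; rewrite /= /GRing.scale /=.
  have := cos2Dsin2 x; rewrite !exprS !natrD -[(2 * n).+1]addn1 natrD.
  set c := cos x; set s := sin x; set y := s ^+ (2 * n) => h.
  have cc : c * c = 1 - s * s by rewrite -h; ring.
  set N := (2 * n)%:R.
  transitivity (s * y * - s + c * c * ((N + 1) * y)); first by ring.
  by rewrite cc; ring.
have E : circ (fun x => (2 * n + 1)%:R * sin x ^+ (2 * n)
     + (- (2 * n + 2)%:R) * sin x ^+ (2 * n).+2) = 0 :> R.
  rewrite (circ_FTC _ _ _ dF); last by cont.
  have -> : sin (2 * pi) = 0 :> R.
    by rewrite -[2 * pi]/(2%:R * pi) mulr_natl sin2pi.
  by rewrite sin0 !exprS !mul0r subrr.
move: E; rewrite circD ?circZ //.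
rewrite -[(2 * n).+2]/(2 + 2 * n)%N -mulnS -/(wallis n) -/(wallis n.+1) => E.
by apply/esym/eqP; rewrite -subr_eq0 -mulNr E.
Qed.

Lemma wallis_ge0 n : 0 <= wallis n.
Proof.
rewrite -(mulr0 (2 * pi)) -circ_cst.
apply: le_circ; [by cont|by cont|move=> x].
by rewrite exprM exprn_ge0 // sqr_ge0.
Qed.

Lemma wallis_le n : wallis n ^+ 2 * n.+1%:R <= (2 * pi) ^+ 2.
Proof.
elim: n => [|n IHn].
  rewrite /wallis muln0 (eq_circ _ (fun=> 1)) ?circ_cst ?mulr1 //.
apply: le_trans IHn.
have h := wallis_rec n; have a0 := wallis_ge0 n; have b0 := wallis_ge0 n.+1.
move: h a0 b0; move: (wallis n) (wallis n.+1) => a b.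
rewrite -[in n.+2]addn2 -[in n.+1]addn1 !natrD.
have := ler0n R n; move: (n%:R) => N N0 h a0 b0.
have {}h : (2 * N + 2) * b = (2 * N + 1) * a by lra.
have e : b = (2 * N + 1) / (2 * N + 2) * a.
  by apply: (@mulfI _ (2 * N + 2)); [|rewrite h; field]; rewrite gt_eqF //; lra.
rewrite e exprMn expr_div_n -mulrA mulrC -mulrA ler_wpM2l ?sqr_ge0 //.
rewrite mulrA ler_pdivrMr ?exprn_gt0 //; last by lra.
by nra.
Qed.

(** Off the zeros of cos, where d <= |cos x|, the difference is at most
    t^2 / (2d). Near them it is at most t, and there 2 sin^(2n) >= 1 by
    Bernoulli's inequality; this power is a polynomial stand-in for the
    indicator of a neighbourhood of the zeros, of small integral for large n. *)
Lemma ell_near0 n d t x : 0 < d -> n%:R * d ^+ 2 <= 2^-1 -> 0 <= t ->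
  ell t x <= ell 0 x + (2 * t * sin x ^+ (2 * n) + t ^+ 2 / (2 * d)).
Proof.
move=> d0 nd t0; rewrite ell0.
have s0 : 0 <= sin x ^+ (2 * n) by rewrite exprM exprn_ge0 // sqr_ge0.
have q0 : 0 <= t ^+ 2 / (2 * d) by rewrite divr_ge0 ?sqr_ge0 // mulr_ge0 // ltW.
have [cd|cd] := leP d `|cos x|.
  suff : ell t x <= `|cos x| + t ^+ 2 / (2 * d).
    by have := mulr_ge0 (mulr_ge0 (ler0n R 2) t0) s0; lra.
  rewrite -ler_sqr ?nnegrE ?ell_ge0 //; last exact: addr_ge0.
  have q : t ^+ 2 / (2 * d) * (2 * d) = t ^+ 2.
    by rewrite divfK // mulf_neq0 // gt_eqF.
  have c2 : `|cos x| ^+ 2 = cos x ^+ 2 by rewrite real_normK ?num_real.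
  rewrite sqr_ell sqrrD c2 -addrA lerD2l.
  have h1 : t ^+ 2 * sin x ^+ 2 <= t ^+ 2.
    by rewrite ler_piMr ?sqr_ge0 // -(cos2Dsin2 x) lerDr sqr_ge0.
  apply: (le_trans h1); move: q0 q; set y := t ^+ 2 / _ => q0 q.
  by have := sqr_ge0 y; nra.
have := ell_lip t 0 x; rewrite ell0 subr0 (ger0_norm t0) => h.
have s1 : 2^-1 <= sin x ^+ (2 * n).
  have c2 : cos x ^+ 2 <= d ^+ 2.
    rewrite -(real_normK (num_real (cos x))).
    by apply: lerXn2r; rewrite ?nnegrE // ltW.
  have ss : sin x ^+ 2 = 1 - cos x ^+ 2 by rewrite -(cos2Dsin2 x); ring.
  have bernoulli m : 1 - m%:R * d ^+ 2 <= sin x ^+ (2 * m).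
    elim: m => [|m IHm]; first by rewrite muln0 expr0 mul0r subr0.
    have y1 : sin x ^+ (2 * m) <= 1.
      by rewrite exprM exprn_ile1 ?sqr_ge0 // -(cos2Dsin2 x) lerDr sqr_ge0.
    have y0 : 0 <= sin x ^+ (2 * m) by rewrite exprM exprn_ge0 // sqr_ge0.
    rewrite mulnS exprD ss -addn1 natrD.
    have c0 := sqr_ge0 (cos x).
    move: c2 IHm y0 y1 c0; move: (sin x ^+ (2 * m)) (cos x ^+ 2) (d ^+ 2) => y c dd *.
    by nra.
  by have := bernoulli n; lra.
by nra.
Qed.

(** First n makes the integral of sin^(2n) small, then t is chosen small in
    terms of the width d = 1 / (2n). *)
Lemma J_slope0 e : 0 < e -> exists t, 0 < t <= 1 /\ J t <= J 0 + e * t.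
Proof.
move=> e0.
have p0 := @pi_gt0 R.
pose n := (Num.trunc (64 / e ^+ 2)).+1.
have n0 : 0 < n%:R :> R by rewrite ltr0n.
have nb : 64 / e ^+ 2 < n%:R by exact: truncnS_gt.
pose d : R := (2 * n%:R)^-1.
have d0 : 0 < d by rewrite invr_gt0 mulr_gt0.
have nd : n%:R * d ^+ 2 <= 2^-1.
  rewrite /d exprVn ler_pdivrMr ?exprn_gt0 ?mulr_gt0 //.
  have : 1 <= n%:R :> R by rewrite ler1n.
  by move: (n%:R) => N *; nra.
have wn : wallis n <= e * pi / 4.
  have h := wallis_le n; have w0 := wallis_ge0 n.
  rewrite -ler_sqr ?nnegrE //; last by rewrite divr_ge0 // mulr_ge0 // ltW.
  have h2 : 64 <= n.+1%:R * e ^+ 2.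
    rewrite -ler_pdivrMr ?exprn_gt0 //; apply/ltW/(lt_trans nb).
    by rewrite ltr_nat.
  have N0 : 0 < n.+1%:R :> R by rewrite ltr0n.
  rewrite -(ler_pM2r N0); apply: (le_trans h).
  move: h2; move: (n.+1%:R) => N; rewrite !exprMn => h2.
  have := sqr_ge0 (@pi R); move: (pi ^+ 2) (e ^+ 2) h2 => P E; nra.
pose t := Num.min 1 (d * e).
have t0 : 0 < t by rewrite lt_min ltr01 mulr_gt0.
have td : t <= d * e by rewrite ge_min lexx orbT.
exists t; split; first by rewrite t0 ge_min lexx.
have cl : continuous (ell 0 : R -> R) := ell_cont 0.
have cn : continuous (fun x : R => 2 * t * sin x ^+ (2 * n)) by cont.
have : circ (ell t) <= circ (fun x => ell 0 x + (2 * t * sin x ^+ (2 * n) + t ^+ 2 / (2 * d))).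
  apply: le_circ; [exact: ell_cont|by cont|move=> x].
  by apply: ell_near0 => //; exact: ltW.
rewrite !circD; try by cont.
rewrite circZ; last by cont.
rewrite -/(wallis n) circ_cst !circ_ell => h.
have h2 : t ^+ 2 / (2 * d) <= t * e / 2.
  rewrite ler_pdivrMr ?mulr_gt0 //.
  have -> : t * e / 2 * (2 * d) = t * (d * e) by field.
  by rewrite expr2 ler_pM2l.
rewrite -(ler_pM2l (@twopi_gt0 R)); apply: (le_trans h).
have : 2 * t * wallis n <= 2 * t * (e * pi / 4) by rewrite ler_pM2l // mulr_gt0.
have : 2 * pi * (t ^+ 2 / (2 * d)) <= 2 * pi * (t * e / 2).
  by rewrite ler_pM2l // twopi_gt0.
have := mulr_gt0 (mulr_gt0 p0 e0) t0.
move: (t ^+ 2 / (2 * d)) (wallis n) (J 0) (@pi R) => y w j p; clearbody t.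
by move=> *; lra.
Qed.

End SlopeAtZero.

(** * The minimizer tau *)

Section Tau.
Context {R : realType}.
Implicit Types t u s K : R.

Lemma J_gt0 t : 0 <= t <= 1 -> 0 < J t.
Proof.
move=> t01; have J00 : 0 < J 0 :> R by rewrite J0 divr_gt0 // pi_gt0.
have [->//|t0] := eqVneq t 0.
have {}t0 : 0 < t by rewrite lt0r t0; case/andP: t01.
rewrite JE mulr_gt0 ?invr_gt0 ?twopi_gt0 //.
have : circ (fun x => t) <= circ (ell t).
  apply: le_circ; [by cont|exact: ell_cont|move=> x].
  case/andP: t01 => _ t1.
  rewrite -ler_sqr ?nnegrE ?ell_ge0 ?(ltW t0) // sqr_ell.
  have := cos2Dsin2 x; have := sqr_ge0 (cos x); have : t ^+ 2 <= 1.
    by rewrite expr_le1 // (ltW t0).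
  by move: (cos x ^+ 2) (sin x ^+ 2) (t ^+ 2) => a b c *; nra.
by apply: lt_le_trans; rewrite circ_cst mulr_gt0 // twopi_gt0.
Qed.

Lemma objE K t : 0 < K -> tau_objective K t = 2 * K * J t / (K + t).
Proof.
move=> K0; rewrite /tau_objective.
have -> : 1 + t / K = (K + t) / K by field; rewrite gt_eqF.
rewrite invf_div; move: (K + t)^-1 => k; ring.
Qed.

(** Cleared of its denominators, the comparison of two values of the objective
    is bilinear in J and in the affine function t |-> K + t. *)
Lemma le_obj K t u : 0 < K -> 0 <= t -> 0 <= u ->
  (tau_objective K t <= tau_objective K u) = (J t * (K + u) <= J u * (K + t)).
Proof.
move=> K0 t0 u0; rewrite !objE // ler_pdivrMr ?ltr_wpDr //.
rewrite [leRHS]mulrAC ler_pdivlMr ?ltr_wpDr // -!mulrA.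
by rewrite ler_pM2l // ler_pM2l.
Qed.

Lemma obj_cont K : 0 < K ->
  {within `[0, 1], continuous (tau_objective K)}.
Proof.
move=> K0; apply: continuous_in_subspaceT => t; rewrite inE /= in_itv /=.
move=> /andP[t0 _].
apply: cvgM.
  by apply: cvgM; [exact: cvg_cst|exact: J_cont].
apply: cvgV; first by rewrite gt_eqF // ltr_wpDr // divr_ge0 // ltW.
by apply: cvgD; [exact: cvg_cst|apply: cvgM; [exact: cvg_id|exact: cvg_cst]].
Qed.

Lemma obj_slope K : 0 < K ->
  exists t, 0 < t <= 1 /\ tau_objective K t < tau_objective K 0.
Proof.
move=> K0; have J00 : 0 < J 0 :> R by apply: J_gt0; rewrite lexx ler01.
have [|t [t01 h]] := @J_slope0 R (J 0 / (2 * K)).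
  by rewrite divr_gt0 // mulr_gt0.
exists t; split => //; case/andP: t01 => t0 t1.
rewrite ltNge le_obj // ?(ltW t0) // -ltNge addr0.
apply: (@le_lt_trans _ _ ((J 0 + J 0 / (2 * K) * t) * K)).
  by rewrite ler_pM2r.
have -> : (J 0 + J 0 / (2 * K) * t) * K = J 0 * (K + t / 2).
  by field; rewrite gt_eqF.
by rewrite ltr_pM2l //; lra.
Qed.

(** A minimizer on the closed interval exists by compactness and is not 0 by
    [obj_slope]. If s is a second one, the affine function m (K + .) touching J
    at both lies above the strictly convex J at their midpoint, where it ought
    to lie below. *)
Lemma exists_unique_minimizer K : 0 < K -> exists t, unique_minimizer K t.
Proof.
move=> K0.
have [t t01 tmin] := EVT_min ler01 (obj_cont K K0).
have {}t01 : 0 <= t <= 1 by move: t01; rewrite in_itv.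
have {}tmin s : 0 <= s <= 1 -> tau_objective K t <= tau_objective K s.
  by move=> s01; apply: tmin; rewrite in_itv.
case/andP: (t01) => t0 t1.
have tn0 : t != 0.
  apply/eqP => te; have [s [/andP[s0 s1]]] := obj_slope K K0.
  by rewrite -te ltNge tmin // (ltW s0) s1.
exists t; split; first by rewrite lt0r tn0 t0.
move=> s /andP[s0 s1] st; rewrite ltNge; apply/negP.
have s01 : 0 <= s <= 1 by rewrite (ltW s0).
rewrite le_obj // ?(ltW s0) // => h1.
have m01 : 0 <= (t + s) / 2 <= 1 by apply/andP; split; lra.
have := tmin _ m01; rewrite le_obj //; last by case/andP: m01.
have := J_strictly_convex t s t01 s01; rewrite eq_sym st => /(_ isT).
have Kt : 0 < K + t by rewrite ltr_wpDr.
move=> h2 h3.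
have : 2 * (J ((t + s) / 2) * (K + t)) < (J t + J s) * (K + t).
  by rewrite mulrA ltr_pM2r.
by lra.
Qed.

Lemma tauP K : 0 < K -> unique_minimizer K (tau K).
Proof. by move=> /exists_unique_minimizer[t]; rewrite /tau; exact: xgetI. Qed.

Lemma tau_min K s : 0 < K -> 0 < s <= 1 -> J (tau K) * (K + s) <= J s * (K + tau K).
Proof.
move=> K0 s01; have [/andP[t0 _] h] := tauP K K0.
have [->//|st] := eqVneq s (tau K).
case/andP: (s01) => s0 _.
by rewrite -le_obj // ?(ltW t0) ?(ltW s0) //; apply/ltW/h.
Qed.

(** The point 1 / K minimizes the upper bound of the objective obtained from
    [J_le_rms]; the resulting value is strictly below the value at 1. *)
Lemma obj_invK_lt K : 1 < K -> tau_objective K K^-1 < 2 * K / (K + 1).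
Proof.
move=> K1; have K0 : 0 < K by lra.
have i0 : 0 < K^-1 by rewrite invr_gt0.
suff H : J K^-1 * (K + 1) < K + K^-1.
  have a0 : 0 < K + K^-1 by apply: addr_gt0.
  rewrite objE // ltr_pdivrMr // [ltRHS]mulrAC ltr_pdivlMr; last by lra.
  by rewrite -(mulrA (2 * K) (J _)) ltr_pM2l // mulr_gt0.
set r := Num.sqrt ((1 + K^-1 ^+ 2) / 2).
have r2 : r ^+ 2 = (1 + K^-1 ^+ 2) / 2.
  by rewrite sqr_sqrtr // divr_ge0 // addr_ge0 // sqr_ge0.
apply: (@le_lt_trans _ _ (r * (K + 1))).
  by rewrite ler_pM2r ?J_le_rms //; lra.
rewrite -ltr_sqr ?nnegrE; last 2 first.
  by rewrite mulr_ge0 ?sqrtr_ge0 //; lra.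
  by rewrite addr_ge0 // ltW.
rewrite exprMn r2.
have e : K * K^-1 = 1 by rewrite mulfV // gt_eqF.
move: K^-1 i0 e => k k0 e.
have : (K + k) ^+ 2 - (1 + k ^+ 2) / 2 * (K + 1) ^+ 2
       = (1 + k ^+ 2) / 2 * (K - 1) ^+ 2.
  have -> : (K + k) ^+ 2 = (1 + k ^+ 2) * (K ^+ 2 + 1) + (K * k * 2 - 1 - (K * k) ^+ 2).
    by ring.
  by rewrite e; field.
have : 0 < (1 + k ^+ 2) / 2 * (K - 1) ^+ 2.
  apply: mulr_gt0; last by rewrite exprn_gt0 // subr_gt0.
  by rewrite divr_gt0 // ltr_wpDr // sqr_ge0.
by lra.
Qed.

Lemma obj1 K : 0 < K -> tau_objective K 1 = 2 * K / (K + 1).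
Proof. by move=> K0; rewrite objE // J1 mulr1. Qed.

Lemma tau_lt1 K : 1 < K -> tau K < 1.
Proof.
move=> K1; have K0 : 0 < K by lra.
have [/andP[t0 t1] h] := tauP K K0.
rewrite lt_neqAle t1 andbT; apply/eqP => e.
have := obj_invK_lt K K1; rewrite -obj1 // ltNge -e => /negP; apply; apply/ltW.
apply: h; rewrite ?invr_gt0 ?K0 ?invf_le1 ?(ltW K1) // e.
by rewrite invr_eq1 gt_eqF.
Qed.

Lemma tau_decreasing K1 K2 : 1 <= K1 -> K1 < K2 -> tau K2 < tau K1.
Proof.
move=> h1 h2; have K10 : 0 < K1 by lra. have K20 : 0 < K2 by lra.
have [/andP[t10 t11] _] := tauP K1 K10.
have [/andP[t20 t21] _] := tauP K2 K20.
have t2lt := tau_lt1 K2 (le_lt_trans h1 h2).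
have m1 s := tau_min K1 s K10; have m2 s := tau_min K2 s K20.
move: (tau K1) (tau K2) t10 t11 t20 t21 t2lt m1 m2.
move=> t1 t2 t10 t11 t20 t21 t2lt m1 m2.
have J10 : 0 < J t1 by apply: J_gt0; rewrite (ltW t10).
have J20 : 0 < J t2 by apply: J_gt0; rewrite (ltW t20).
(* Multiply the optimality of t1 tested at t2 by that of t2 tested at t1; the
   values of J cancel. *)
have le : t2 <= t1.
  have a := m1 t2; have b := m2 t1; rewrite t20 t21 in a; rewrite t10 t11 in b.
  move: {a}(a isT) {b}(b isT) => a b.
  have c : (K1 + t2) * (K2 + t1) <= (K1 + t1) * (K2 + t2).
    rewrite -(ler_pM2l (mulr_gt0 J10 J20)).
    have -> : J t1 * J t2 * ((K1 + t2) * (K2 + t1))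
              = (J t1 * (K1 + t2)) * (J t2 * (K2 + t1)) by ring.
    have -> : J t1 * J t2 * ((K1 + t1) * (K2 + t2))
              = (J t2 * (K1 + t1)) * (J t1 * (K2 + t2)) by ring.
    by apply: ler_pM => //; rewrite mulr_ge0 ?ltW //; lra.
  by rewrite leNgt; apply/negP => lt; nra.
rewrite lt_neqAle le andbT; apply/eqP => e; move: t2lt m2; rewrite e => t1lt m2.
(* D is the difference of the slopes of the two lines supporting J at the
   common minimizer t1; the step h keeps t1 + h and t1 - h in ]0, 1] and makes
   D h exceed h^2 / t1. *)
have JJ := J_second_difference t1.
have Kt1 : 0 < K1 + t1 by lra. have Kt2 : 0 < K2 + t1 by lra.
pose D := J t1 / (K1 + t1) - J t1 / (K2 + t1).
have D0 : 0 < D by rewrite subr_gt0 ltr_pM2l // ltf_pV2 ?posrE //; lra.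
pose h := Num.min (Num.min (t1 / 2) (1 - t1)) (D * t1 / 2).
have hh : [/\ 0 < h, h <= t1 / 2, h <= 1 - t1 & h <= D * t1 / 2].
  split; rewrite ?lt_min ?ge_min ?lexx ?orbT //.
  by rewrite !divr_gt0 ?mulr_gt0 //= subr_gt0 t1lt.
case: hh; clearbody h => h0 ha hb hc.
have p : J t1 + J t1 / (K1 + t1) * h <= J (t1 + h).
  have -> : J t1 + J t1 / (K1 + t1) * h = J t1 * (K1 + (t1 + h)) / (K1 + t1).
    by field; rewrite gt_eqF.
  by rewrite ler_pdivrMr // m1 //; apply/andP; split; lra.
have q : J t1 - J t1 / (K2 + t1) * h <= J (t1 - h).
  have -> : J t1 - J t1 / (K2 + t1) * h = J t1 * (K2 + (t1 - h)) / (K2 + t1).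
    by field; rewrite gt_eqF.
  by rewrite ler_pdivrMr // m2 //; apply/andP; split; lra.
have := JJ h t10.
have : h ^+ 2 / t1 <= D * h / 2.
  rewrite ler_pdivrMr // expr2.
  by rewrite (_ : D * h / 2 * t1 = h * (D * t1 / 2)) ?ler_pM2l //; ring.
have : 0 < D * h by exact: mulr_gt0.
by rewrite /D; lra.
Qed.

End Tau.

(** * First Fourier coefficients of harmonic functions *)

Section Differential2.
Context {R : realType} {W : normedModType R}.
Implicit Types (F : R * R -> W) (p v : R * R) (a b : R -> R).

Lemma derive_gradE F p v : differentiable F p ->
  'D_v F p = v.1 *: 'D_(1, 0) F p + v.2 *: 'D_(0, 1) F p.
Proof.
move=> dF; rewrite !deriveE //.
have {1}-> : v = v.1 *: (1, 0) + v.2 *: (0, 1).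
  case: v => v1 v2 /=; apply/pair_equal_spec; split.
    by rewrite /= /GRing.scale /= mulr1 mulr0 addr0.
  by rewrite /= /GRing.scale /= mulr1 mulr0 add0r.
by rewrite linearD !linearZ.
Qed.

Lemma is_derive_comp2 F a b (x a' b' : R) : differentiable F (a x, b x) ->
  is_derive x (1 : R) a a' -> is_derive x (1 : R) b b' ->
  is_derive x (1 : R) (fun y => F (a y, b y))
    (a' *: 'D_(1, 0) F (a x, b x) + b' *: 'D_(0, 1) F (a x, b x)).
Proof.
move=> dF [da <-] [db <-].
have {}da : differentiable a x by apply/derivable1_diffP.
have {}db : differentiable b x by apply/derivable1_diffP.
have dp : differentiable (fun y => (a y, b y)) x by exact: differentiable_pair.
have dg : differentiable (F \o (fun y => (a y, b y))) x by exact: differentiable_comp.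
apply: DeriveDef; first exact/derivable1_diffP.
rewrite -[fun y => _]/(F \o (fun y => (a y, b y))) deriveE // diff_comp //=.
rewrite diff_pair //= -!deriveE //.
by rewrite (derive_gradE _ _ ('D_1 a x, 'D_1 b x)).
Qed.

End Differential2.

Section CircleDerive.
Context {R : realType}.
Notation mu := (@lebesgue_measure R).

(** Differentiation under the integral sign. The dominating constant is the
    maximum of |W| on a compact rectangle [-rho, rho] x [0, 2 pi], with rho
    between |r| and 1. *)
Lemma circ_derive (V W : R -> R -> R) (r : R) : -1 < r < 1 ->
  (forall s : R, -1 < s < 1 -> continuous (V s)) ->
  (forall s t : R, -1 < s < 1 -> is_derive s (1 : R) (V ^~ t) (W s t)) ->
  (forall s t : R, -1 < s < 1 -> {for (s, t), continuous (fun p : R * R => W p.1 p.2)}) ->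
  is_derive r (1 : R) (fun s => circ (V s)) (circ (W r)).
Proof.
move=> r1 cV dV cW.
have [rho [rrho rho1]] : exists rho, `|r| < rho /\ rho < 1.
  exists ((`|r| + 1) / 2).
  have : `|r| < 1 by rewrite ltr_norml.
  by move: (`|r|) => *; split; lra.
have rho0 : 0 < rho by apply: le_lt_trans rrho.
have sub (s : R) : s \in `[- rho, rho] -> -1 < s < 1.
  by rewrite in_itv /= => /andP[? ?]; apply/andP; split; lra.
pose A := (`[- rho, rho] `*` `[0, 2 * pi] : set (R * R)).
have [C HC] : exists C, forall p, A p -> `|W p.1 p.2| <= C.
  have [|||c _ H] := @compact_EVT_max _ R (fun p : R * R => `|W p.1 p.2|) A.
  - exists (0, 0); split; rewrite /= in_itv /=; apply/andP; split => //; try lra.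
    by rewrite ltW // twopi_gt0.
  - by apply: compact_setX; exact: segment_compact.
  - apply: continuous_in_subspaceT => p; rewrite inE => -[/= p1 p2].
    apply: continuous_comp; last exact: norm_continuous.
    by case: p p1 p2 => s t /= /sub p1 _; exact: cW.
  by exists `|W c.1 c.2| => p Ap; apply: H; rewrite inE.
pose G := fun _ : R => C.
have iV (s : R) : `]- rho, rho[%classic s -> mu.-integrable `[0, 2 * pi] (EFin \o V s).
  move=> /= h; apply: circ_integrable; apply: cV; apply: sub.
  exact: subset_itv_oo_cc h.
have dV1 (s t : R) : `]- rho, rho[%classic s -> `[0, 2 * pi]%classic t -> derivable (V ^~ t) s 1.
  by move=> /= h _; have [] := dV s t (sub _ (subset_itv_oo_cc h)).
have Ir : `]- rho, rho[%classic r by rewrite /= in_itv /= -ltr_norml.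
have d1E (s t : R) : -1 < s < 1 -> partial1of2 V s t = W s t.
  by move=> h; rewrite partial1of2E; have [] := dV s t h.
have C0 : 0 <= C.
  apply: le_trans (HC (0, 0) _); first exact: normr_ge0.
  split; rewrite /= in_itv /=; apply/andP; split => //; try lra.
  by rewrite ltW // twopi_gt0.
have iG : mu.-integrable `[0, 2 * pi] (EFin \o G).
  by apply: circ_integrable; exact: contK.
have Gub (s t : R) : `]- rho, rho[%classic s -> `[0, 2 * pi]%classic t ->
    `|partial1of2 V s t| <= G t.
  move=> /= hs ht; have hs' := subset_itv_oo_cc hs.
  by rewrite d1E ?sub //; apply: (HC (s, t)).
apply: DeriveDef.
  exact: (@derivable_under_integral R _ _ mu V _ (measurable_itv _) _ _ _ Ir iV dV1 G (fun=> C0) iG Gub).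
rewrite -derive1E.
rewrite (@differentiation_under_integral R _ _ mu V _ (measurable_itv _) _ _ _ Ir iV dV1 G (fun=> C0) iG Gub).
by apply: eq_Rintegral => t _; rewrite d1E.
Qed.

(** The solutions of s^2 I'' + s I' = I are spanned by s and 1 / s, and the
    second is singular at 0. With P = s I' - I, the equation says that s P has
    derivative 0, hence P = 0 and then I'' = 0 away from 0. *)
Lemma euler_ode_regular (I0 I1 I2 : R -> R) (r : R) : 0 <= r < 1 ->
  (forall s : R, -1 < s < 1 -> is_derive s (1 : R) I0 (I1 s)) ->
  (forall s : R, -1 < s < 1 -> is_derive s (1 : R) I1 (I2 s)) ->
  (forall s : R, -1 < s < 1 -> s ^+ 2 * I2 s + s * I1 s = I0 s) ->
  I0 r = r * I1 0.
Proof.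
move=> /andP[r0 r1] d0 d1 ode.
have I00 : I0 0 = 0.
  by rewrite -ode ?mul0r ?expr0n ?mul0r ?add0r //; apply/andP; split; lra.
have [->|rn0] := eqVneq r 0; first by rewrite mul0r.
have {rn0}r0 : 0 < r by rewrite lt0r rn0.
have incl (s a b : R) : s \in `[a, b] -> 0 <= a -> b < 1 -> -1 < s < 1.
  by rewrite in_itv /= => /andP[? ?] *; apply/andP; split; lra.
have cont_of (f f' : R -> R) b : b < 1 -> (forall s : R, -1 < s < 1 -> is_derive s (1 : R) f (f' s)) ->
    {within `[0, b], continuous f}.
  move=> b1 df; apply: derivable_within_continuous => s /incl => /(_ (lexx 0) b1) h.
  by have [] := df s h.
have P0 (s : R) : 0 < s < 1 -> s * (s * I1 s - I0 s) = 0.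
  move=> /andP[s0 s1].
  pose f := fun s => s * (s * I1 s - I0 s).
  have df (u : R) : -1 < u < 1 -> is_derive u (1 : R) f 0.
    move=> hu; have := d0 u hu; have := d1 u hu => h1 h2.
    apply: is_derive_eq; rewrite /GRing.scale /=.
    by have := ode u hu; nra.
  have [|c _] := @MVT R f (fun=> 0) 0 s s0 _ (cont_of _ _ _ s1 df).
    by move=> u /subset_itv_oo_cc /incl /(_ (lexx _) s1); exact: df.
  by rewrite mul0r /f mul0r subr0.
have I20 (s : R) : 0 < s < 1 -> I2 s = 0.
  move=> /andP[s0 s1].
  have := P0 s; rewrite s0 s1 => /(_ isT) /eqP; rewrite mulf_eq0 gt_eqF //= => /eqP P.
  have /eqP : s ^+ 2 * I2 s = 0.
    have := ode s; rewrite s1 (lt_trans _ s0) ?ltrN10 // => /(_ isT).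
    by lra.
  by rewrite mulf_eq0 expf_eq0 /= gt_eqF //= => /eqP.
have I1r : I1 r = I1 0.
  have [|c c0r] := @MVT R I1 I2 0 r r0 _ (cont_of _ _ _ r1 d1).
    by move=> u /subset_itv_oo_cc /incl /(_ (lexx _) r1); exact: d1.
  rewrite I20 ?mul0r; first by move/eqP; rewrite subr_eq0 => /eqP.
  by move: c0r; rewrite in_itv /= => /andP[-> /lt_trans]; apply.
have := P0 r; rewrite r0 r1 I1r => /(_ isT) /eqP.
by rewrite mulf_eq0 gt_eqF //= subr_eq0 => /eqP.
Qed.

End CircleDerive.

Lemma cont_pair {T U V : topologicalType} (f : T -> U) (g : T -> V) (x : T) :
  {for x, continuous f} -> {for x, continuous g} ->
  {for x, continuous (fun y => (f y, g y))}.
Proof.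
by move=> cf cg; exact: (@cvg_pair _ _ _ _ (nbhs (f x)) (nbhs (g x)) _ _ _ f g).
Qed.

Lemma is_derive_mulr {R : realType} (f : R -> R) (c x d : R) :
  is_derive x (1 : R) f d -> is_derive x (1 : R) (fun y => f y * c) (d * c).
Proof. by move=> h; apply: is_derive_eq; rewrite /GRing.scale /=; ring. Qed.

(** The weight k, with derivative k', will be cos or sin; phi is the
    angle of the direction in which the differential is read off. *)
Section CircleMoment.
Context {R : realType}.
Variables (u : R * R -> R) (phi : R) (k k' : R -> R).
Hypothesis hu : harmonic_on_disk u.
Hypothesis dk : forall x : R, is_derive x (1 : R) k (k' x).
Hypothesis dk' : forall x : R, is_derive x (1 : R) k' (- k x).
Hypotheses (kper : k (2 * pi) = k 0) (k'per : k' (2 * pi) = k' 0).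

Let ck : continuous k.
Proof.
move=> x; apply: differentiable_continuous.
by apply/derivable1_diffP; have [] := dk x.
Qed.

Let pos (r t : R) : R * R := (r * cos (t + phi), r * sin (t + phi)).

Let pos_disk r t : -1 < r < 1 -> unit_disk (pos r t).
Proof.
move=> /andP[r0 r1]; rewrite /unit_disk /= !exprMn -mulrDr cos2Dsin2 mulr1.
by nra.
Qed.

Let cc : continuous (fun p : R * R => cos (p.2 + phi)).
Proof.
move=> p; apply: (@continuous_comp _ _ _ (fun p : R * R => p.2 + phi) cos).
  by apply: cvgD; [exact: cvg_snd|exact: cvg_cst].
exact: continuous_cos.
Qed.

Let cs : continuous (fun p : R * R => sin (p.2 + phi)).
Proof.
move=> p; apply: (@continuous_comp _ _ _ (fun p : R * R => p.2 + phi) sin).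
  by apply: cvgD; [exact: cvg_snd|exact: cvg_cst].
exact: continuous_sin.
Qed.

Let ck2 : continuous (fun p : R * R => k p.2).
Proof. by move=> p; apply: continuous_comp; [exact: cvg_snd|exact: ck]. Qed.

Let cpos : continuous (fun p : R * R => pos p.1 p.2).
Proof.
move=> p; apply: (cont_pair (fun p : R * R => p.1 * cos (p.2 + phi))
                              (fun p => p.1 * sin (p.2 + phi))).
  by apply: cvgM; [exact: cvg_fst|exact: cc].
by apply: cvgM; [exact: cvg_fst|exact: cs].
Qed.

Let cfpos (f : R * R -> R) (r t : R) : {for pos r t, continuous f} ->
  {for (r, t), continuous (fun p : R * R => f (pos p.1 p.2))}.
Proof. by move=> cf; apply: continuous_comp; [exact: cpos|exact: cf]. Qed.

Let cslice (f : R * R -> R) (r : R) :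
  (forall t, {for (r, t), continuous f}) -> continuous (fun t => f (r, t)).
Proof.
move=> cf t; apply: (@continuous_comp _ _ _ (fun t => (r, t)) f); last exact: cf.
by apply: (cont_pair (fun=> r) id); [exact: cvg_cst|exact: cvg_id].
Qed.

Let u1 := 'D_(1, 0) u.
Let u2 := 'D_(0, 1) u.

Let du p : unit_disk p -> differentiable u p.
Proof. by move=> hp; have [[/(_ p hp)[]]] := hu. Qed.
Let du1 p : unit_disk p -> differentiable u1 p.
Proof. by move=> hp; have [[_ /(_ (1, 0) p hp)[]]] := hu. Qed.
Let du2 p : unit_disk p -> differentiable u2 p.
Proof. by move=> hp; have [[_ /(_ (0, 1) p hp)[]]] := hu. Qed.
Let c1 v p : unit_disk p -> {for p, continuous ('D_v u1)}.
Proof. by move=> hp; case: hu => -[_ H] _; case: (H (1, 0) p hp) => _ /(_ v). Qed.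
Let c2 v p : unit_disk p -> {for p, continuous ('D_v u2)}.
Proof. by move=> hp; case: hu => -[_ H] _; case: (H (0, 1) p hp) => _ /(_ v). Qed.

Let Ur r t := cos (t + phi) * u1 (pos r t) + sin (t + phi) * u2 (pos r t).
Let Urr r t :=
  cos (t + phi) * (cos (t + phi) * 'D_(1, 0) u1 (pos r t)
                   + sin (t + phi) * 'D_(0, 1) u1 (pos r t))
  + sin (t + phi) * (cos (t + phi) * 'D_(1, 0) u2 (pos r t)
                   + sin (t + phi) * 'D_(0, 1) u2 (pos r t)).
Let Ut r t := r * (- sin (t + phi) * u1 (pos r t) + cos (t + phi) * u2 (pos r t)).

Let dr (f : R * R -> R) (r t : R) : differentiable f (pos r t) ->
  is_derive r (1 : R) (fun s => f (pos s t))
    (cos (t + phi) * 'D_(1, 0) f (pos r t) + sin (t + phi) * 'D_(0, 1) f (pos r t)).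
Proof.
move=> df; apply: is_derive_comp2 => //.
  by apply: is_derive_eq; rewrite /GRing.scale /=; ring.
by apply: is_derive_eq; rewrite /GRing.scale /=; ring.
Qed.

Let dt (f : R * R -> R) (r t : R) : differentiable f (pos r t) ->
  is_derive t (1 : R) (fun s => f (pos r s))
    (r * (- sin (t + phi) * 'D_(1, 0) f (pos r t)
          + cos (t + phi) * 'D_(0, 1) f (pos r t))).
Proof.
move=> df.
have dp : is_derive t (1 : R) (fun s => s + phi) 1.
  by apply: is_derive_eq; rewrite addr0.
have dC : is_derive t (1 : R) (fun s => r * cos (s + phi)) (r * - sin (t + phi)).
  by apply: is_derive_eq; rewrite /GRing.scale /=; ring.
have dS : is_derive t (1 : R) (fun s => r * sin (s + phi)) (r * cos (t + phi)).
  by apply: is_derive_eq; rewrite /GRing.scale /=; ring.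
have := is_derive_comp2 f _ _ t _ _ df dC dS.
by rewrite /GRing.scale /= mulrDr !mulrA.
Qed.

(** The Laplacian in polar coordinates. The two mixed second derivatives occur
    only through their sum, in [Urr] as well as in the derivative of [Ut]. *)
Let Ut_derive (r t : R) : -1 < r < 1 ->
  is_derive t (1 : R) (Ut r) (- (r ^+ 2 * Urr r t + r * Ur r t)).
Proof.
move=> r1; have hp := pos_disk r t r1.
have d1 := dt u1 r t (du1 _ hp).
have d2 := dt u2 r t (du2 _ hp).
have dC : is_derive t (1 : R) (fun s => cos (s + phi)) (- sin (t + phi)).
  by apply: is_derive_eq; rewrite /GRing.scale /=; ring.
have dS : is_derive t (1 : R) (fun s => - sin (s + phi)) (- cos (t + phi)).
  by apply: is_derive_eq; rewrite /GRing.scale /=; ring.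
have lap : 'D_(1, 0) u1 (pos r t) + 'D_(0, 1) u2 (pos r t) = 0.
  by have [_ /(_ _ hp)] := hu.
apply: is_derive_eq; rewrite /GRing.scale /= /Urr /Ur.
move: lap; set a := 'D_(1, 0) u1 _; set b := 'D_(0, 1) u1 _.
set c := 'D_(1, 0) u2 _; set d := 'D_(0, 1) u2 _ => lap.
have -> : d = - a by apply/eqP; rewrite -addr_eq0 addrC lap.
ring.
Qed.

Let I0 r := circ (fun t => u (pos r t) * k t).
Let I1 r := circ (fun t => Ur r t * k t).
Let I2 r := circ (fun t => Urr r t * k t).

Let cV0 (r t : R) : -1 < r < 1 ->
  {for (r, t), continuous (fun p : R * R => u (pos p.1 p.2) * k p.2)}.
Proof.
move=> r1; have hp := pos_disk r t r1.
apply: cvgM; last exact: ck2.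
exact/cfpos/differentiable_continuous/du.
Qed.

Let cV1 (r t : R) : -1 < r < 1 ->
  {for (r, t), continuous (fun p : R * R => Ur p.1 p.2 * k p.2)}.
Proof.
move=> r1; have hp := pos_disk r t r1.
apply: cvgM; last exact: ck2.
apply: cvgD; apply: cvgM; [exact: cc| |exact: cs|].
  exact/cfpos/differentiable_continuous/du1.
exact/cfpos/differentiable_continuous/du2.
Qed.

Let cV2 (r t : R) : -1 < r < 1 ->
  {for (r, t), continuous (fun p : R * R => Urr p.1 p.2 * k p.2)}.
Proof.
move=> r1; have hp := pos_disk r t r1.
apply: cvgM; last exact: ck2.
apply: cvgD; apply: cvgM; [exact: cc| |exact: cs|];
  apply: cvgD; apply: cvgM; try exact: cc; try exact: cs.
- exact: (cfpos ('D_(1, 0) u1) _ _ (c1 _ _ hp)).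
- exact: (cfpos ('D_(0, 1) u1) _ _ (c1 _ _ hp)).
- exact: (cfpos ('D_(1, 0) u2) _ _ (c2 _ _ hp)).
- exact: (cfpos ('D_(0, 1) u2) _ _ (c2 _ _ hp)).
Qed.

Let dI0 (r : R) : -1 < r < 1 -> is_derive r (1 : R) I0 (I1 r).
Proof.
move=> r1; apply: (circ_derive (fun r t => u (pos r t) * k t)
                               (fun r t => Ur r t * k t)) => //.
- move=> s s1; apply: (cslice (fun p => u (pos p.1 p.2) * k p.2)) => t.
  exact: cV0.
- move=> s t s1; have := dr u s t (du _ (pos_disk s t s1)) => h.
  exact: is_derive_mulr.
Qed.

Let dI1 (r : R) : -1 < r < 1 -> is_derive r (1 : R) I1 (I2 r).
Proof.
move=> r1; apply: (circ_derive (fun r t => Ur r t * k t)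
                               (fun r t => Urr r t * k t)) => //.
- move=> s s1; apply: (cslice (fun p => Ur p.1 p.2 * k p.2)) => t.
  exact: cV1.
- move=> s t s1; have hp := pos_disk s t s1.
  have h1 := dr u1 s t (du1 _ hp); have h2 := dr u2 s t (du2 _ hp).
  exact: is_derive_mulr.
Qed.

(** Integrating U_tt k by parts twice, without boundary terms by periodicity,
    gives minus the integral of U k. *)
Let ode (r : R) : -1 < r < 1 -> r ^+ 2 * I2 r + r * I1 r = I0 r.
Proof.
move=> r1.
have k0 : continuous (fun t => u (pos r t) * k t).
  by apply: (cslice (fun p => u (pos p.1 p.2) * k p.2)) => t; exact: cV0.
have k1 : continuous (fun t => Ur r t * k t).
  by apply: (cslice (fun p => Ur p.1 p.2 * k p.2)) => t; exact: cV1.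
have k2 : continuous (fun t => Urr r t * k t).
  by apply: (cslice (fun p => Urr p.1 p.2 * k p.2)) => t; exact: cV2.
pose f t := u (pos r t) * k t + ((- r ^+ 2) * (Urr r t * k t) + (- r) * (Ur r t * k t)).
have k12 : continuous (fun t => (- r ^+ 2) * (Urr r t * k t) + (- r) * (Ur r t * k t)).
  by apply: contD; apply: contM => //; exact: contK.
have cf : continuous f by exact: contD.
(* f is the derivative of U_t k - U k', and so integrates to 0. *)
have dF (t : R) : is_derive t (1 : R)
    (fun t => Ut r t * k t - u (pos r t) * k' t) (f t).
  have h1 := Ut_derive r t r1; have h2 := dt u r t (du _ (pos_disk r t r1)).
  have h3 := dk t; have h4 := dk' t.
  by apply: is_derive_eq; rewrite /GRing.scale /= /f /Ut /u1 /u2 /=; ring.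
have := circ_FTC _ _ cf dF.
have perc : cos (2 * pi + phi) = cos phi.
  by rewrite addrC -[2 * pi]/(2%:R * pi) mulr_natl cosD2pi.
have pers : sin (2 * pi + phi) = sin phi.
  by rewrite addrC -[2 * pi]/(2%:R * pi) mulr_natl sinD2pi.
rewrite /Ut /pos perc pers !add0r kper k'per subrr.
rewrite /f circD //.
rewrite circD; [|by apply: contM => //; exact: contK|by apply: contM => //; exact: contK].
rewrite !circZ // -/(I0 r) -/(I1 r) -/(I2 r); lra.
Qed.

Lemma circle_moment (r : R) : 0 <= r < 1 ->
  circ (fun t => u (r * cos (t + phi), r * sin (t + phi)) * k t)
  = r * circ (fun t => (cos (t + phi) * 'D_(1, 0) u (0, 0)
                        + sin (t + phi) * 'D_(0, 1) u (0, 0)) * k t).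
Proof.
move=> r1; rewrite -[LHS]/(I0 r) (euler_ode_regular _ _ _ r r1 dI0 dI1 ode).
by congr (_ * _); apply: eq_circ => t; rewrite /Ur /pos !mul0r.
Qed.

End CircleMoment.

Lemma circle_continuous {R : realType} (u : R * R -> R) (phi r : R) :
  harmonic_on_disk u -> -1 < r < 1 ->
  continuous (fun t => u (r * cos (t + phi), r * sin (t + phi))).
Proof.
move=> hu r1 t.
have cp : continuous (fun t : R => t + phi) by cont.
apply: (@continuous_comp _ _ _ (fun t => (r * cos (t + phi), r * sin (t + phi))) u).
  have cx : continuous (fun t : R => r * cos (t + phi)) by cont.
  have cy : continuous (fun t : R => r * sin (t + phi)) by cont.
  exact: cont_pair (cx t) (cy t).
apply: differentiable_continuous.
have [[/(_ (r * cos (t + phi), r * sin (t + phi)))[]]] := hu => //.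
rewrite /unit_disk /= !exprMn -mulrDr cos2Dsin2 mulr1.
by case/andP: r1 => *; nra.
Qed.

Section FirstFourier.
Context {R : realType}.
Implicit Types (u : R * R -> R) (phi r : R).

Let ccos : continuous (fun x : R => cos x ^+ 2). Proof. by cont. Qed.
Let csin : continuous (fun x : R => sin x ^+ 2). Proof. by cont. Qed.

Lemma circ_cos2 : circ (fun x => cos x ^+ 2) = pi :> R.
Proof.
have : circ (fun x => cos x ^+ 2) + circ (fun x => sin x ^+ 2) = 2 * pi :> R.
  rewrite -circD // (eq_circ _ (fun=> 1)) ?circ_cst ?mulr1 // => x.
  exact: cos2Dsin2.
by rewrite circ_sin2; move: (@pi R) => p; lra.
Qed.

Lemma circ_sincos : circ (fun x => sin x * cos x) = 0 :> R.
Proof.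
have dF (x : R) : is_derive x (1 : R) (fun x => 2^-1 * sin x ^+ 2) (sin x * cos x).
  by apply: is_derive_eq; rewrite /GRing.scale /=; field.
rewrite (circ_FTC _ _ _ dF); last by cont.
rewrite -[2 * pi]/(2%:R * pi) mulr_natl sin2pi sin0; ring.
Qed.

Let combine (a b c : R) :
  circ (fun t => a * cos t ^+ 2 + (b * (sin t * cos t) + c * sin t ^+ 2))
  = pi * (a + c).
Proof.
rewrite circD; [|by cont|by cont].
rewrite circD; [|by cont|by cont].
rewrite !circZ; [|by cont|by cont|by cont].
by rewrite circ_cos2 circ_sin2 circ_sincos; move: (@pi R) => p; ring.
Qed.

Lemma cos_moment u phi r : harmonic_on_disk u -> 0 <= r < 1 ->
  circ (fun t => u (r * cos (t + phi), r * sin (t + phi)) * cos t)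
  = pi * r * 'D_(cos phi, sin phi) u (0, 0).
Proof.
move=> hu r1; rewrite (circle_moment u phi cos (fun x => - sin x)) //; last 2 first.
- by rewrite -[2 * pi]/(2%:R * pi) mulr_natl cos2pi cos0.
- by rewrite -[2 * pi]/(2%:R * pi) mulr_natl sin2pi sin0.
have d0 : differentiable u (0, 0).
  by have [[/(_ (0, 0))[]]] := hu => //; rewrite /unit_disk /= expr0n addr0.
rewrite [in RHS]derive_gradE //= /GRing.scale /=.
set a := 'D_(1, 0) u _; set b := 'D_(0, 1) u _.
rewrite (eq_circ _ (fun t => (cos phi * a + sin phi * b) * cos t ^+ 2
   + ((cos phi * b - sin phi * a) * (sin t * cos t) + 0 * sin t ^+ 2))).
  by rewrite combine; move: (@pi R) => p; ring.
by move=> t; rewrite cosD sinD; ring.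
Qed.

Lemma sin_moment u phi r : harmonic_on_disk u -> 0 <= r < 1 ->
  circ (fun t => u (r * cos (t + phi), r * sin (t + phi)) * sin t)
  = pi * r * 'D_(- sin phi, cos phi) u (0, 0).
Proof.
move=> hu r1; rewrite (circle_moment u phi sin cos) //; last 2 first.
- by rewrite -[2 * pi]/(2%:R * pi) mulr_natl sin2pi sin0.
- by rewrite -[2 * pi]/(2%:R * pi) mulr_natl cos2pi cos0.
have d0 : differentiable u (0, 0).
  by have [[/(_ (0, 0))[]]] := hu => //; rewrite /unit_disk /= expr0n addr0.
rewrite [in RHS]derive_gradE //= /GRing.scale /=.
set a := 'D_(1, 0) u _; set b := 'D_(0, 1) u _.
rewrite (eq_circ _ (fun t => 0 * cos t ^+ 2
   + ((cos phi * a + sin phi * b) * (sin t * cos t)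
      + (cos phi * b - sin phi * a) * sin t ^+ 2))).
  by rewrite combine; move: (@pi R) => p; ring.
by move=> t; rewrite cosD sinD; ring.
Qed.

End FirstFourier.

(** * Stability of harmonicity on the disk *)

Section NearEq.
Context {R : realType} {V W : normedModType R}.

(** Differentiability at p is stated through the global function, so its local
    character goes through this case. *)
Lemma near0_differentiable (k : V -> W) (p : V) :
  (\near p, k p = 0) -> differentiable k p.
Proof.
move=> k0.
have o0 : k \o shift p = cst (k p) + (\0 : V -> W) +o_ 0 id.
  apply/eqaddoP => e e0; rewrite /= !fctE (nbhs_singleton k0).
  have : \forall h \near 0, k (h + p) = 0 by move: k0; rewrite (near_shift 0) /= subr0.
  apply: filterS => h hk.
  have -> : k (h + p) - (0 + \0 h) = 0 by rewrite hk !add0r; exact: oppr0.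
  rewrite normr0.
  by apply: mulr_ge0 => //; exact: ltW.
have c0 : continuous (\0 : {linear V -> W}) by move=> x; exact: cvg_cst.
have d0 := diff_unique c0 o0.
apply/diff_locallyP; split; first by rewrite d0.
by rewrite {1}o0 d0.
Qed.

Lemma near_eq_differentiable (f g : V -> W) (p : V) :
  (\near p, f p = g p) -> differentiable f p -> differentiable g p.
Proof.
move=> fg df; have -> : g = f + (g - f) by apply/funext => x; rewrite !fctE addrC subrK.
apply: differentiableD => //; apply: near0_differentiable.
by apply: filterS fg => x; rewrite !fctE => ->; rewrite subrr.
Qed.

End NearEq.

Section HarmonicClosure.
Context {R : realType} {V W : normedModType R}.
Implicit Types f g : R * R -> V.

Lemma open_unit_disk : open (@unit_disk R).
Proof.
have c : continuous (fun p : R * R => p.1 ^+ 2 + p.2 ^+ 2).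
  move=> p; apply: cvgD; apply: (@cvgM _ _ _ _ _ _ _ _ _); by [exact: cvg_fst|exact: cvg_snd].
by apply: (open_comp (fun p _ => c p) (@open_lt R 1)).
Qed.

(** Maps are prescribed on the disk only; this turns equality there into
    equality near a point, under which derivatives do not change. *)
Lemma near_disk f g p : (forall q, unit_disk q -> f q = g q) -> unit_disk p ->
  \near p, f p = g p.
Proof.
move=> fg hp; have /open_nbhs_nbhs : open_nbhs p (@unit_disk R).
  by split => //; exact: open_unit_disk.
exact: filterS.
Qed.

Lemma C1_on_eq f g : (forall p, unit_disk p -> f p = g p) ->
  C1_on (@unit_disk R) f -> C1_on (@unit_disk R) g.
Proof.
move=> fg cf p hp; have [df cD] := cf p hp.
split; first exact: near_eq_differentiable (near_disk _ _ _ fg hp) df.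
move=> v; have E q : unit_disk q -> 'D_v f q = 'D_v g q.
  by move=> hq; apply: near_eq_derive; exact: near_disk.
rewrite /prop_for /continuous_at /= -E //.
by apply: cvg_trans (cD v); apply: near_eq_cvg; exact: near_disk.
Qed.

Lemma derive_add f g v p : C1_on (@unit_disk R) f -> C1_on (@unit_disk R) g ->
  unit_disk p -> 'D_v (fun q => f q + g q) p = 'D_v f p + 'D_v g p.
Proof.
move=> cf cg hp; apply: deriveD.
  by apply: diff_derivable; have [] := cf p hp.
by apply: diff_derivable; have [] := cg p hp.
Qed.

Lemma C1_on_add f g : C1_on (@unit_disk R) f -> C1_on (@unit_disk R) g ->
  C1_on (@unit_disk R) (fun q => f q + g q).
Proof.
move=> cf cg p hp; have [df Df] := cf p hp; have [dg Dg] := cg p hp.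
split; first exact: differentiableD.
move=> v; rewrite /prop_for /continuous_at /= derive_add //.
apply: (cvg_trans _ (cvgD (Df v) (Dg v))); apply: near_eq_cvg.
by apply: near_disk => // q hq; rewrite derive_add.
Qed.

Lemma harmonic_add f g : harmonic_on_disk f -> harmonic_on_disk g ->
  harmonic_on_disk (fun q => f q + g q).
Proof.
move=> [[f1 f2] lf] [[g1 g2] lg].
have E v q : unit_disk q -> 'D_v f q + 'D_v g q = 'D_v (fun q => f q + g q) q.
  by move=> hq; rewrite derive_add.
split.
  split; first exact: C1_on_add.
  by move=> v; apply: C1_on_eq (E v) _; exact: C1_on_add.
move=> p hp; have := lf p hp; have := lg p hp; rewrite /laplacian => hg hf.
have D v : 'D_v ('D_v (fun q => f q + g q)) p = 'D_v ('D_v f) p + 'D_v ('D_v g) p.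
  rewrite -derive_add //; apply/esym/near_eq_derive.
  exact: near_disk (E v) hp.
by rewrite !D addrACA hf hg addr0.
Qed.

Variable L : {linear V -> W}.
Hypothesis cL : continuous L.

Lemma derive_lin f v p : differentiable f p -> 'D_v (fun q => L (f q)) p = L ('D_v f p).
Proof.
move=> df; rewrite -[fun q => _]/(L \o f).
have dL : differentiable L (f p) by exact: linear_differentiable.
rewrite (deriveE v (differentiable_comp df dL)) (deriveE v df).
rewrite (diff_comp df dL) /=.
by rewrite (diff_lin _ cL).
Qed.

Lemma C1_on_lin f : C1_on (@unit_disk R) f -> C1_on (@unit_disk R) (fun q => L (f q)).
Proof.
move=> cf p hp; have [df Df] := cf p hp; split.
  by apply: (@differentiable_comp _ _ _ _ f L) => //; exact: linear_differentiable.
move=> v; have E q : unit_disk q -> L ('D_v f q) = 'D_v (fun q => L (f q)) q.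
  by move=> /cf[? _]; rewrite derive_lin.
rewrite /prop_for /continuous_at /= -E //.
have : L ('D_v f q) @[q --> p] --> L ('D_v f p).
  exact: (@cvg_comp _ _ _ _ L _ _ _ (Df v) (cL _)).
apply: cvg_trans; apply: near_eq_cvg.
have /open_nbhs_nbhs : open_nbhs p (@unit_disk R).
  by split => //; exact: open_unit_disk.
by apply: filterS => q /E.
Qed.

End HarmonicClosure.

Lemma harmonic_lin {R : realType} {V W : normedModType R} (L : {linear V -> W})
    (cL : continuous L) (f : R * R -> V) :
  harmonic_on_disk f -> harmonic_on_disk (fun q => L (f q)).
Proof.
move=> [[f1 f2] lf].
have E v q : unit_disk q -> L ('D_v f q) = 'D_v (fun q => L (f q)) q.
  by move=> /f1[? _]; rewrite derive_lin.
split.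
  split; first exact: C1_on_lin.
  by move=> v; apply: C1_on_eq (E v) _; exact: C1_on_lin.
move=> p hp; have := lf p hp; rewrite /laplacian => hf.
have D v : 'D_v ('D_v (fun q => L (f q))) p = L ('D_v ('D_v f) p).
  rewrite -derive_lin //; last by have [] := f2 v p hp.
  by apply/esym/near_eq_derive; exact: near_disk (E v) hp.
by rewrite !D -linearD hf linear0.
Qed.

(** * Linear maps from the plane to an inner product space *)

Section Hilbert.
Context {R : realType} {H : normedModType R} (dot : {dot H for idfun}).
Hypothesis norm_dot : forall x : H, `|x| ^+ 2 = dot x x.
Implicit Types (x y z e f : H) (a b : R).

Lemma dotC x y : dot x y = dot y x.
Proof. by rewrite hermC /= expr0 mul1r. Qed.

Lemma dotDr x y z : dot x (y + z) = dot x y + dot x z.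
Proof. by rewrite linearD. Qed.

Lemma dotZr a x y : dot x (a *: y) = a * dot x y.
Proof. by rewrite linearZ. Qed.

Lemma dotDl x y z : dot (y + z) x = dot y x + dot z x.
Proof. by rewrite ![dot _ x]dotC dotDr. Qed.

Lemma dotZl a x y : dot (a *: y) x = a * dot y x.
Proof. by rewrite ![dot _ x]dotC dotZr. Qed.

Lemma norm_comb2 a b x y :
  `|a *: x + b *: y| ^+ 2 = a ^+ 2 * `|x| ^+ 2 + b ^+ 2 * `|y| ^+ 2 + 2 * a * b * dot x y.
Proof.
rewrite !norm_dot dotDl !dotDr !dotZl !dotZr (dotC y x); ring.
Qed.

Lemma dot_le x y : dot x y <= `|x| * `|y|.
Proof.
have [->|x0] := eqVneq x 0; first by rewrite linear0l normr0 mul0r.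
have [->|y0] := eqVneq y 0; first by rewrite linear0 normr0 mulr0.
have X : 0 < `|x| by rewrite normr_gt0.
have Y : 0 < `|y| by rewrite normr_gt0.
have := sqr_ge0 `| `|y| *: x + (- `|x|) *: y|.
rewrite norm_comb2 sqrrN => h.
have {h} : 0 <= 2 * (`|x| * `|y|) * (`|x| * `|y| - dot x y).
  by apply: le_trans h _; rewrite le_eqVlt; apply/orP; left; apply/eqP; ring.
by rewrite pmulr_rge0 ?mulr_gt0 // subr_ge0.
Qed.

Lemma dot_abs_le x y : `|dot x y| <= `|x| * `|y|.
Proof.
rewrite ler_norml dot_le andbT lerNl -mulN1r -dotZl.
by apply: le_trans (dot_le _ _) _; rewrite scaleN1r normrN.
Qed.

Lemma dot_linear e : linear (dot ^~ e : H -> R).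
Proof. by move=> a x y; rewrite /= dotDl dotZl. Qed.

(** Taking the inner product with e, packed as a linear map so that the results
    on linear maps and derivatives apply. *)
Definition dotr e : {linear H -> R} :=
  HB.pack (dot ^~ e : H -> R) (GRing.isLinear.Build _ _ _ _ _ (dot_linear e)).

Lemma dotrE e x : dotr e x = dot x e.
Proof. by []. Qed.

Lemma continuous_dotr e : continuous (dotr e).
Proof.
apply: bounded_linear_continuous; apply/linear_boundedP.
exists `|e|; split; first exact: num_real.
move=> r er x; rewrite dotrE; apply: le_trans (dot_abs_le _ _) _.
by rewrite mulrC ler_wpM2r // ltW.
Qed.

Implicit Types (A : {linear (R * R)%type -> H}) (phi : R).
Definition vdir phi : R * R := (cos phi, sin phi).
Definition wdir phi : R * R := (- sin phi, cos phi).

Lemma circle_frame phi p : unit_circle p ->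
  exists a b, a ^+ 2 + b ^+ 2 = 1 /\ p = a *: vdir phi + b *: wdir phi.
Proof.
case: p => p q; rewrite /unit_circle /= => pq.
exists (p * cos phi + q * sin phi), (- p * sin phi + q * cos phi).
have cs := cos2Dsin2 phi; split.
  transitivity ((p ^+ 2 + q ^+ 2) * (cos phi ^+ 2 + sin phi ^+ 2)); first by ring.
  by rewrite pq cs mulr1.
rewrite /vdir /wdir; apply/pair_equal_spec; split; rewrite /= /GRing.scale /=.
  rewrite -[LHS]mulr1 -cs; ring.
rewrite -[LHS]mulr1 -cs; ring.
Qed.

Lemma vdir_circle phi : unit_circle (vdir phi).
Proof. exact: cos2Dsin2. Qed.

Lemma wdir_circle phi : unit_circle (wdir phi).
Proof. by rewrite /unit_circle /= sqrrN addrC cos2Dsin2. Qed.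

(** The inner product of the images of the frame is q at the angle 0 and - q at
    pi / 2, so it vanishes in between. The frame can then be turned by a
    quarter turn to put the larger image first. *)
Lemma exists_conjugate_directions A :
  exists phi, dot (A (vdir phi)) (A (wdir phi)) = 0 /\
    `|A (wdir phi)| <= `|A (vdir phi)|.
Proof.
pose psi phi := dot (A (vdir phi)) (A (wdir phi)).
suff [phi psi0] : exists phi, psi phi = 0.
  have [le|/ltW le] := leP (`|A (wdir phi)|) (`|A (vdir phi)|).
    by exists phi.
  have vE : vdir (phi + pi / 2) = wdir phi by rewrite /vdir /wdir cosDpihalf sinDpihalf.
  have wE : wdir (phi + pi / 2) = - vdir phi.
    by rewrite /vdir /wdir cosDpihalf sinDpihalf.
  exists (phi + pi / 2); rewrite vE wE linearN normrN; split => //.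
  by rewrite -scaleN1r dotZr dotC -/(psi phi) psi0 mulr0.
pose a := A (1, 0); pose b := A (0, 1).
have AE p q : A (p, q) = p *: a + q *: b.
  rewrite -!linearZ -linearD; congr (A _); apply/pair_equal_spec.
  by rewrite /= /GRing.scale /= !mulr1 !mulr0 addr0 add0r.
have psiE phi : psi phi = cos phi * sin phi * (dot b b - dot a a)
    + (cos phi ^+ 2 - sin phi ^+ 2) * dot a b.
  rewrite /psi !AE !dotDl !dotDr !dotZl !dotZr (dotC b a); ring.
have psi0 : psi 0 = dot a b by rewrite psiE cos0 sin0; ring.
have psi1 : psi (pi / 2) = - dot a b by rewrite psiE cos_pihalf sin_pihalf; ring.
have cpsi : continuous psi.
  have -> : psi = fun phi => cos phi * sin phi * (dot b b - dot a a)
    + (cos phi ^+ 2 - sin phi ^+ 2) * dot a b by apply/funext.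
  by cont.
have [|||phi _ h] := @IVT R psi 0 (pi / 2) 0.
- by rewrite divr_ge0 // pi_ge0.
- exact: continuous_subspaceT.
- rewrite psi0 psi1; move: (dot a b) => q.
  rewrite ge_min le_max oppr_le0 oppr_ge0.
  by case/orP: (le_total q 0) => ->; rewrite ?orbT.
by exists phi.
Qed.

(** At A = 'd F (0, 0) these are [max_stretch F] and [min_stretch F]. *)
Definition max_norm A : R := sup [set `|A v| | v in @unit_circle R].
Definition min_norm A : R := inf [set `|A v| | v in @unit_circle R].

Lemma norm_frame A phi a b : dot (A (vdir phi)) (A (wdir phi)) = 0 ->
  `|A (a *: vdir phi + b *: wdir phi)| ^+ 2
  = a ^+ 2 * `|A (vdir phi)| ^+ 2 + b ^+ 2 * `|A (wdir phi)| ^+ 2.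
Proof.
by move=> o; rewrite linearD !linearZ norm_comb2 o mulr0 addr0.
Qed.

Lemma max_norm_conjugate A phi : dot (A (vdir phi)) (A (wdir phi)) = 0 ->
  `|A (wdir phi)| <= `|A (vdir phi)| -> max_norm A = `|A (vdir phi)|.
Proof.
move=> o le; rewrite /max_norm; set S := (X in sup X).
have ub : ubound S (`|A (vdir phi)|).
  move=> _ [p /(circle_frame phi)[a [b [ab ->]]] <-].
  rewrite -ler_sqr ?nnegrE // norm_frame //.
  have := sqr_ge0 b; have le2 : `|A (wdir phi)| ^+ 2 <= `|A (vdir phi)| ^+ 2.
    by rewrite ler_sqr ?nnegrE.
  move: ab le2; move: (a ^+ 2) (b ^+ 2) (_ ^+ 2) (_ ^+ 2) => *; nra.
have inS : S `|A (vdir phi)| by exists (vdir phi) => //; exact: vdir_circle.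
apply/eqP; rewrite eq_le; apply/andP; split; first by apply: sup_le_ub ub; exists (`|A (vdir phi)|).
by apply: ub_le_sup => //; exists (`|A (vdir phi)|).
Qed.

Lemma min_norm_conjugate A phi : dot (A (vdir phi)) (A (wdir phi)) = 0 ->
  `|A (wdir phi)| <= `|A (vdir phi)| -> min_norm A = `|A (wdir phi)|.
Proof.
move=> o le; rewrite /min_norm; set S := (X in inf X).
have lb : lbound S (`|A (wdir phi)|).
  move=> _ [p /(circle_frame phi)[a [b [ab ->]]] <-].
  rewrite -ler_sqr ?nnegrE // norm_frame //.
  have := sqr_ge0 a; have le2 : `|A (wdir phi)| ^+ 2 <= `|A (vdir phi)| ^+ 2.
    by rewrite ler_sqr ?nnegrE.
  move: ab le2; move: (a ^+ 2) (b ^+ 2) (_ ^+ 2) (_ ^+ 2) => *; nra.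
have inS : S `|A (wdir phi)| by exists (wdir phi) => //; exact: wdir_circle.
apply/eqP; rewrite eq_le; apply/andP; split.
  by apply: ge_inf => //; exists (`|A (wdir phi)|).
by apply: lb_le_inf lb; exists (`|A (wdir phi)|).
Qed.

Lemma exists_stretch_frame (F : R * R -> H) :
  exists phi, let A := 'd F (0, 0) in
  [/\ dot (A (vdir phi)) (A (wdir phi)) = 0,
      `|A (wdir phi)| <= `|A (vdir phi)|,
      max_stretch F = `|A (vdir phi)| & min_stretch F = `|A (wdir phi)|].
Proof.
pose A := 'd F (0, 0).
have [phi [orth le]] := exists_conjugate_directions A.
exists phi; split => //.
  exact: max_norm_conjugate orth le.
exact: min_norm_conjugate orth le.
Qed.

End Hilbert.

(** * Upper bound for the stretch *)

Section UpperBound.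
Context {R : realType} {H : normedModType R} (dot : {dot H for idfun}).
Hypothesis norm_dot : forall x : H, `|x| ^+ 2 = dot x x.
Implicit Types (F : R * R -> H) (e f : H) (phi r t : R).

Lemma disk0 : @unit_disk R (0, 0).
Proof. by rewrite /unit_disk /= expr0n addr0 ltr01. Qed.

Lemma harmonic_differentiable0 F : harmonic_on_disk F -> differentiable F (0, 0).
Proof. by move=> [[/(_ _ disk0)[]]]. Qed.

Lemma harmonic_dot F e : harmonic_on_disk F -> harmonic_on_disk (fun p => dot (F p) e).
Proof. exact: (harmonic_lin (dotr dot e) (continuous_dotr dot norm_dot e)). Qed.

Lemma derive_dot F e v : harmonic_on_disk F ->
  'D_v (fun p => dot (F p) e) (0, 0) = dot ('d F (0, 0) v) e.
Proof.
move=> hF; have dF := harmonic_differentiable0 F hF.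
have := derive_lin (dotr dot e) (continuous_dotr dot norm_dot e) F v (0, 0) dF.
by rewrite dotrE (deriveE _ dF).
Qed.

(** The Fourier coefficients of F in the directions e and f, against the
    Cauchy-Schwarz bound on the same integral. *)
Lemma fourier_pairing F phi r t e f : harmonic_on_disk F ->
  (forall p, unit_disk p -> `|F p| < 1) ->
  `|e| = 1 -> `|f| = 1 -> dot e f = 0 -> 0 <= r < 1 ->
  pi * r * (dot ('d F (0, 0) (vdir phi)) e + t * dot ('d F (0, 0) (wdir phi)) f)
  <= 2 * pi * J t.
Proof.
move=> hF F1 e1 f1 ef r1; have [r0 r1'] := andP r1.
have r1n : -1 < r < 1 by rewrite r1' andbT; lra.
pose ue p := dot (F p) e; pose uf p := dot (F p) f.
have he : harmonic_on_disk ue by exact: harmonic_dot.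
have hf : harmonic_on_disk uf by exact: harmonic_dot.
pose z x : R * R := (r * cos (x + phi), r * sin (x + phi)).
have ce : continuous (fun x => ue (z x)) by exact: circle_continuous.
have cf : continuous (fun x => uf (z x)) by exact: circle_continuous.
have c1 : continuous (fun x => ue (z x) * cos x).
  by apply: contM => //; exact: continuous_cos.
have c2 : continuous (fun x => uf (z x) * sin x).
  by apply: contM => //; exact: continuous_sin.
have c3 : continuous (fun x => t * (uf (z x) * sin x)).
  by apply: contM => //; exact: contK.
have zd x : unit_disk (z x).
  by rewrite /unit_disk /z /= !exprMn -mulrDr cos2Dsin2 mulr1 expr_lt1.
rewrite -circ_ell.
have <- : circ (fun x => ue (z x) * cos x + t * (uf (z x) * sin x))
  = pi * r * (dot ('d F (0, 0) (vdir phi)) e + t * dot ('d F (0, 0) (wdir phi)) f).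
  rewrite circD // circZ // (cos_moment ue) // (sin_moment uf) //.
  rewrite !derive_dot // -/(vdir phi) -/(wdir phi).
  by move: (@pi R) => p; ring.
apply: le_circ; [exact: contD|exact: ell_cont|move=> x].
have -> : ue (z x) * cos x + t * (uf (z x) * sin x)
  = dot (F (z x)) (cos x *: e + (t * sin x) *: f).
  by rewrite dotDr !dotZr /ue /uf; ring.
apply: le_trans (dot_le dot norm_dot _ _) _.
have -> : `|cos x *: e + (t * sin x) *: f| = ell t x.
  apply/eqP; rewrite -(@eqrXn2 _ 2) ?ell_ge0 //.
  by rewrite (norm_comb2 dot norm_dot) e1 f1 ef sqr_ell; apply/eqP; ring.
by rewrite -[leRHS]mul1r ler_wpM2r ?ell_ge0 // ltW // F1.
Qed.

(** Let r tend to 1 in [fourier_pairing]. *)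
Lemma stretch_sum_le F phi t : harmonic_on_disk F ->
  (forall p, unit_disk p -> `|F p| < 1) ->
  let A := 'd F (0, 0) in
  dot (A (vdir phi)) (A (wdir phi)) = 0 ->
  A (vdir phi) != 0 -> A (wdir phi) != 0 ->
  `|A (vdir phi)| + t * `|A (wdir phi)| <= 2 * J t.
Proof.
move=> hF F1 A o Av0 Aw0.
set a := A (vdir phi) in o Av0 *; set b := A (wdir phi) in o Aw0 *.
have na : `|a| != 0 by rewrite normr_eq0.
have nb : `|b| != 0 by rewrite normr_eq0.
have unit (x : H) : `|x| != 0 -> `| `|x|^-1 *: x| = 1.
  by move=> nx; rewrite normrZ normfV normr_id mulVf.
have ef : dot (`|a|^-1 *: a) (`|b|^-1 *: b) = 0 by rewrite dotZl dotZr o !mulr0.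
have proj (x : H) : `|x| != 0 -> dot x (`|x|^-1 *: x) = `|x|.
  by move=> nx; rewrite dotZr -norm_dot expr2 mulKf.
have key r : 0 <= r < 1 -> r * (`|a| + t * `|b|) <= 2 * J t.
  move=> r1; have := fourier_pairing F phi r t _ _ hF F1 (unit _ na) (unit _ nb) ef r1.
  rewrite -/A -/a -/b !proj // => h.
  by rewrite -(ler_pM2l (@pi_gt0 R)) mulrA [leRHS]mulrA [pi * 2]mulrC.
rewrite leNgt; apply/negP => lt.
have J0 := J_ge0 t.
set X := _ + _ in key lt; set Y := 2 * J t in key lt.
have Y0 : 0 <= Y by rewrite mulr_ge0.
have X0 : 0 < X by apply: le_lt_trans lt.
have YX : Y / X < 1 by rewrite ltr_pdivrMr // mul1r.
have YX0 : 0 <= Y / X by rewrite divr_ge0 // ltW.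
(* This radius lies strictly between Y / X and 1. *)
have := key ((1 + Y / X) / 2).
have -> : (1 + Y / X) / 2 * X = (X + Y) / 2 by field; rewrite gt_eqF.
have -> : 0 <= (1 + Y / X) / 2 < 1 by apply/andP; split; lra.
by move=> /(_ isT); lra.
Qed.

Lemma max_stretch_le F K t : 0 < K -> admissible K F -> 0 <= t ->
  max_stretch F <= tau_objective K t.
Proof.
move=> K0 [hF F1 _ [l0 /andP[_ LK]]] t0.
have [phi [orth le maxE minE]] := exists_stretch_frame dot norm_dot F.
pose A := 'd F (0, 0); rewrite -/A in orth le maxE minE.
rewrite maxE minE in l0 LK *.
have Aw0 : A (wdir phi) != 0 by rewrite -normr_gt0.
have Av0 : A (vdir phi) != 0 by rewrite -normr_gt0 (lt_le_trans l0).
have := stretch_sum_le F phi t hF F1 orth Av0 Aw0; rewrite -/A => h.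
rewrite /tau_objective ler_pdivlMr; last by rewrite ltr_wpDr // divr_ge0 // ltW.
apply: le_trans h; rewrite mulrDr mulr1 lerD2l mulrCA ler_wpM2l //.
by rewrite ler_pdivrMr // mulrC.
Qed.

End UpperBound.

(** * The harmonic function of extremal slope *)

Section Criterion.
Context {R : realType}.
Implicit Types (f g : R * R -> R) (p v : R * R).

Definition grad_on_disk f (f1 f2 : R * R -> R) : Prop :=
  forall p, unit_disk p -> differentiable f p /\
    forall v, is_derive p v f (v.1 * f1 p + v.2 * f2 p).

Lemma C1_on_grad f f1 f2 : grad_on_disk f f1 f2 ->
  (forall p, unit_disk p -> {for p, continuous f1} /\ {for p, continuous f2}) ->
  C1_on (@unit_disk R) f.
Proof.
move=> gf cf p hp; have [df _] := gf p hp; split => // v.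
have E q : unit_disk q -> v.1 * f1 q + v.2 * f2 q = 'D_v f q.
  by move=> /gf[_ /(_ v)[]].
have [c1 c2] := cf p hp.
rewrite /prop_for /continuous_at /= -E //.
have C : (v.1 * f1 q + v.2 * f2 q) @[q --> p] --> (v.1 * f1 p + v.2 * f2 p).
  by apply: cvgD; apply: cvgM; [exact: cvg_cst|exact: c1|exact: cvg_cst|exact: c2].
by apply: cvg_trans C; apply: near_eq_cvg; apply: near_disk => // q /E ->.
Qed.

(** Explicit first and second partial derivatives suffice: the directional
    derivatives are their combinations on the disk. *)
Lemma harmonic_criterion f f1 f2 f11 f12 f21 f22 :
  grad_on_disk f f1 f2 -> grad_on_disk f1 f11 f12 -> grad_on_disk f2 f21 f22 ->
  (forall p, unit_disk p -> [/\ {for p, continuous f11}, {for p, continuous f12},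
     {for p, continuous f21} & {for p, continuous f22}]) ->
  (forall p, unit_disk p -> f11 p + f22 p = 0) ->
  harmonic_on_disk f.
Proof.
move=> gf g1 g2 cf lap.
have dv v : grad_on_disk (fun p => v.1 * f1 p + v.2 * f2 p)
    (fun p => v.1 * f11 p + v.2 * f21 p) (fun p => v.1 * f12 p + v.2 * f22 p).
  move=> p hp; have [d1 D1] := g1 p hp; have [d2 D2] := g2 p hp; split.
    apply: (@differentiableD _ _ _ (fun p => v.1 * f1 p) (fun p => v.2 * f2 p)).
      by apply: (@differentiableM _ _ (fun=> v.1) f1).
    by apply: (@differentiableM _ _ (fun=> v.2) f2).
  move=> w; have h1 := D1 w; have h2 := D2 w.
  by apply: is_derive_eq; rewrite /GRing.scale /=; ring.
have E v q : unit_disk q -> v.1 * f1 q + v.2 * f2 q = 'D_v f q.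
  by move=> /gf[_ /(_ v)[]].
split; [split|].
- apply: C1_on_grad gf _ => p hp; have [d1 _] := g1 p hp; have [d2 _] := g2 p hp.
  by split; exact: differentiable_continuous.
- move=> v; apply: C1_on_eq (E v) _; apply: C1_on_grad (dv v) _ => p hp.
  have [c11 c12 c21 c22] := cf p hp.
  by split; apply: cvgD; apply: cvgM; (exact: cvg_cst || assumption).
- move=> p hp; rewrite /laplacian.
  have DD v w : 'D_w ('D_v f) p = w.1 * (v.1 * f11 p + v.2 * f21 p)
      + w.2 * (v.1 * f12 p + v.2 * f22 p).
    have [_ /(_ w)[_ <-]] := dv v p hp.
    by apply/esym/near_eq_derive; exact: near_disk (E v) hp.
  by rewrite !DD -[RHS](lap p hp) /=; ring.
Qed.

End Criterion.

Section Calculus2.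
Context {R : realType}.
Implicit Types (f g : R * R -> R) (p v : R * R).

Lemma dfD f g p : differentiable f p -> differentiable g p ->
  differentiable (fun q => f q + g q) p.
Proof. exact: differentiableD. Qed.

Lemma dfM f g p : differentiable f p -> differentiable g p ->
  differentiable (fun q => f q * g q) p.
Proof. exact: differentiableM. Qed.

Lemma dfN f p : differentiable f p -> differentiable (fun q => - f q) p.
Proof. exact: differentiableN. Qed.

Lemma df2 f p : differentiable f p -> differentiable (fun q => f q ^+ 2) p.
Proof. by move=> df; apply: dfM. Qed.

Lemma dfV f p : f p != 0 -> differentiable f p -> differentiable (fun q => (f q)^-1) p.
Proof. by move=> f0 df; exact: differentiableV. Qed.

Lemma df_fst p : differentiable (fun q : R * R => q.1) p.
Proof.
have c : continuous (fst : {linear (R * R)%type -> R}) by move=> q; exact: cvg_fst.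
exact: (linear_differentiable p c).
Qed.

Lemma df_snd p : differentiable (fun q : R * R => q.2) p.
Proof.
have c : continuous (snd : {linear (R * R)%type -> R}) by move=> q; exact: cvg_snd.
exact: (linear_differentiable p c).
Qed.

Lemma df_cst c p : differentiable (fun _ : R * R => c : R) p.
Proof. exact: differentiable_cst. Qed.

Lemma is_derive_fst p v : is_derive p v (fun q : R * R => q.1) v.1.
Proof.
apply: DeriveDef; first exact/diff_derivable/df_fst.
rewrite deriveE; last exact: df_fst.
have c : continuous (fst : {linear (R * R)%type -> R}) by move=> q; exact: cvg_fst.
by have -> := diff_lin p c.
Qed.

Lemma is_derive_snd p v : is_derive p v (fun q : R * R => q.2) v.2.
Proof.
apply: DeriveDef; first exact/diff_derivable/df_snd.
rewrite deriveE; last exact: df_snd.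
have c : continuous (snd : {linear (R * R)%type -> R}) by move=> q; exact: cvg_snd.
by have -> := diff_lin p c.
Qed.

Lemma is_derive_quot f g p v (f' g' : R) : g p != 0 ->
  is_derive p v f f' -> is_derive p v g g' ->
  is_derive p v (fun q => f q / g q) ((f' * g p - f p * g') / g p ^+ 2).
Proof.
move=> g0 df [dg Dg].
have dV : is_derive p v (fun q => (g q)^-1) (- (g p) ^- 2 * g').
  by apply: DeriveDef; [exact: derivableV|rewrite deriveV // Dg].
by apply: is_derive_eq; rewrite /GRing.scale /=; field.
Qed.

Lemma is_derive_atan f p v (f' : R) : differentiable f p ->
  is_derive p v f f' ->
  differentiable (fun q => atan (f q)) p /\
  is_derive p v (fun q => atan (f q)) (f' / (1 + f p ^+ 2)).
Proof.
move=> df [_ Df].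
have [da Da] := is_derive1_atan (f p).
have {}da : differentiable (@atan R) (f p) by apply/derivable1_diffP.
have dc : differentiable (fun q => atan (f q)) p.
  exact: (@differentiable_comp _ _ _ _ f (@atan R)).
split => //; apply: DeriveDef; first exact: diff_derivable.
rewrite deriveE // (@diff_comp _ _ _ _ f (@atan R)) //= -(deriveE v df) Df.
by rewrite diff1E // derive1E Da.
Qed.

End Calculus2.

Ltac dif :=
  lazymatch goal with
  | |- differentiable fst _ => exact: df_fst
  | |- differentiable snd _ => exact: df_snd
  | |- differentiable (fun q => _ + _) _ => apply: dfD; dif
  | |- differentiable (fun q => _ * _) _ => apply: dfM; dif
  | |- differentiable (fun q => - _) _ => apply: dfN; dif
  | |- differentiable (fun q => _ ^+ 2) _ => apply: df2; dif
  | |- differentiable (fun q => _^-1) _ => apply: dfV; [by [] | dif]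
  | |- _ => first [assumption | exact: df_cst]
  end.

Section StripMap.
Context {R : realType}.
Variables a b : R.
Hypothesis ab : a ^+ 2 + b ^+ 2 = 1.
Implicit Types p v : R * R.

Let xi p : R := a * p.1 + b * p.2.
Let rho p : R := 1 - (p.1 ^+ 2 + p.2 ^+ 2).
Let den p : R := rho p ^+ 2 + 4 * xi p ^+ 2.
Let n1 p : R := rho p * a + 2 * p.1 * xi p.
Let n2 p : R := rho p * b + 2 * p.2 * xi p.

(** (2 / pi) times the argument of (1 + z) / (1 - z), up to a rotation: it is the
    imaginary part of a conformal map of the disk onto a strip. *)
Definition strip p : R := 2 / pi * atan (2 * xi p / rho p).

Let rho_gt0 p : unit_disk p -> 0 < rho p.
Proof. by rewrite /unit_disk /= /rho => h; lra. Qed.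

Let den_gt0 p : unit_disk p -> 0 < den p.
Proof.
move=> /rho_gt0 r0; rewrite /den ltr_wpDr ?exprn_gt0 //.
by rewrite mulr_ge0 // sqr_ge0.
Qed.

Let dxi p : differentiable xi p. Proof. by rewrite /xi; dif. Qed.
Let drho p : differentiable rho p. Proof. by rewrite /rho; dif. Qed.
Let dden p : differentiable den p. Proof. by have := dxi p; have := drho p; rewrite /den => *; dif. Qed.
Let dn1 p : differentiable n1 p. Proof. by have := dxi p; have := drho p; rewrite /n1 => *; dif. Qed.
Let dn2 p : differentiable n2 p. Proof. by have := dxi p; have := drho p; rewrite /n2 => *; dif. Qed.

Let Dxi p v : is_derive p v xi (a * v.1 + b * v.2).
Proof.
have h1 := is_derive_fst p v; have h2 := is_derive_snd p v.
by apply: is_derive_eq; rewrite /GRing.scale /=; ring.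
Qed.
Let Drho p v : is_derive p v rho (- (2 * p.1 * v.1 + 2 * p.2 * v.2)).
Proof.
have h1 := is_derive_fst p v; have h2 := is_derive_snd p v.
by apply: is_derive_eq; rewrite /GRing.scale /=; ring.
Qed.
Let Dden p v : is_derive p v den
  (v.1 * (8 * xi p * a - 4 * p.1 * rho p) + v.2 * (8 * xi p * b - 4 * p.2 * rho p)).
Proof.
have h1 := Dxi p v; have h2 := Drho p v.
by apply: is_derive_eq; rewrite /GRing.scale /=; ring.
Qed.
Let Dn1 p v : is_derive p v n1 (v.1 * (2 * xi p) + v.2 * (2 * p.1 * b - 2 * p.2 * a)).
Proof.
have h1 := Dxi p v; have h2 := Drho p v; have h3 := is_derive_fst p v.
by apply: is_derive_eq; rewrite /GRing.scale /= /xi; ring.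
Qed.
Let Dn2 p v : is_derive p v n2 (v.1 * (2 * p.2 * a - 2 * p.1 * b) + v.2 * (2 * xi p)).
Proof.
have h1 := Dxi p v; have h2 := Drho p v; have h3 := is_derive_snd p v.
by apply: is_derive_eq; rewrite /GRing.scale /= /xi; ring.
Qed.

Let c := 4 / pi : R.
Let g1 p : R := c * (n1 p / den p).
Let g2 p : R := c * (n2 p / den p).
Let g11 p : R := c * ((2 * xi p * den p - n1 p * (8 * xi p * a - 4 * p.1 * rho p)) / den p ^+ 2).
Let g12 p : R := c * (((2 * p.1 * b - 2 * p.2 * a) * den p - n1 p * (8 * xi p * b - 4 * p.2 * rho p)) / den p ^+ 2).
Let g21 p : R := c * (((2 * p.2 * a - 2 * p.1 * b) * den p - n2 p * (8 * xi p * a - 4 * p.1 * rho p)) / den p ^+ 2).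
Let g22 p : R := c * ((2 * xi p * den p - n2 p * (8 * xi p * b - 4 * p.2 * rho p)) / den p ^+ 2).

(** The denominators rho of the argument of atan cancel against
    1 + (2 xi / rho)^2 = den / rho^2, leaving quotients by den, which is
    positive on the disk. *)
Let grad_strip : grad_on_disk strip g1 g2.
Proof.
move=> p hp; have r0 := rho_gt0 p hp; have d0 := den_gt0 p hp.
have rn0 : rho p != 0 by rewrite gt_eqF.
have dn0 : den p != 0 by rewrite gt_eqF.
have dh : differentiable (fun q => 2 * xi q / rho q) p.
  by have := dxi p; have := drho p => *; dif.
have D2 v : is_derive p v (fun q => 2 * xi q) (2 * (a * v.1 + b * v.2)).
  by have h := Dxi p v; apply: is_derive_eq; rewrite /GRing.scale /=; ring.
have Dh v := is_derive_quot _ _ _ _ _ _ rn0 (D2 v) (Drho p v).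
split.
  have [da _] := is_derive_atan _ _ _ _ dh (Dh (1, 0)).
  by rewrite /strip; apply: dfM => //; exact: df_cst.
move=> v; have [_ Da] := is_derive_atan _ _ _ _ dh (Dh v).
apply: is_derive_eq; rewrite /GRing.scale /= /g1 /g2 /c.
have p0 := lt0r_neq0 (@pi_gt0 R); move: (@pi R) p0 => P P0.
have e : 1 + (2 * xi p / rho p) ^+ 2 = den p / rho p ^+ 2.
  by rewrite /den; field.
rewrite e /n1 /n2; move: rn0 dn0; move: (den p) (rho p) (xi p) => D r x rn0 dn0.
by field; rewrite rn0 dn0 P0.
Qed.

Let grad_quot (n n' n'' : R * R -> R) : (forall p, differentiable n p) ->
  (forall p v, is_derive p v n (v.1 * n' p + v.2 * n'' p)) ->
  grad_on_disk (fun p => c * (n p / den p))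
   (fun p => c * ((n' p * den p - n p * (8 * xi p * a - 4 * p.1 * rho p)) / den p ^+ 2))
   (fun p => c * ((n'' p * den p - n p * (8 * xi p * b - 4 * p.2 * rho p)) / den p ^+ 2)).
Proof.
move=> dn Dn p hp.
have dn0 : den p != 0 by rewrite gt_eqF // den_gt0.
split; first by have := dn p; have := dden p => *; dif.
move=> v; have h := is_derive_quot _ _ _ _ _ _ dn0 (Dn p v) (Dden p v).
apply: is_derive_eq; rewrite /GRing.scale /=.
move: (n' p) (n'' p) (n p) (rho p) (xi p) dn0; move: (den p) => D n1' n2' N r x dn0.
by field.
Qed.

Lemma strip_harmonic : harmonic_on_disk strip.
Proof.
apply: (@harmonic_criterion _ strip g1 g2 g11 g12 g21 g22).
- exact: grad_strip.
- exact: (grad_quot _ _ _ dn1 Dn1).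
- exact: (grad_quot _ _ _ dn2 Dn2).
- move=> p hp; have d2 : den p ^+ 2 != 0 by rewrite expf_eq0 /= gt_eqF // den_gt0.
  have dx := dxi p; have dr := drho p; have dd := dden p; have e1 := dn1 p; have e2 := dn2 p.
  by split; apply: differentiable_continuous;
    rewrite /g11 /g12 /g21 /g22; dif.
- move=> p hp; have dn0 : den p != 0 by rewrite gt_eqF // den_gt0.
  rewrite /g11 /g22 -mulrDr -mulrDl.
  suff -> : 2 * xi p * den p - n1 p * (8 * xi p * a - 4 * p.1 * rho p)
    + (2 * xi p * den p - n2 p * (8 * xi p * b - 4 * p.2 * rho p)) = 0.
    by rewrite mul0r mulr0.
  transitivity (4 * xi p * den p - 8 * xi p * rho p * (a ^+ 2 + b ^+ 2)
    + 4 * rho p ^+ 2 * xi p - 16 * xi p ^+ 3 + 8 * xi p * rho p * (p.1 ^+ 2 + p.2 ^+ 2)).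
    by rewrite /n1 /n2 /xi; ring.
  by rewrite ab /den /rho; ring.
Qed.

Lemma strip_lt1 p : `|strip p| < 1.
Proof.
have p0 := @pi_gt0 R; rewrite /strip normrM ger0_norm; last by rewrite divr_ge0 // ltW.
rewrite -ltr_pdivlMl ?divr_gt0 // mulr1 invf_div ltr_norml.
by rewrite atan_gtNpi2 atan_ltpi2.
Qed.

Lemma strip0 : strip (0, 0) = 0.
Proof. by rewrite /strip /xi /= !mulr0 addr0 mulr0 mul0r atan0 mulr0. Qed.

Lemma derive_strip0 v : 'D_v strip (0, 0) = 4 / pi * (a * v.1 + b * v.2).
Proof.
have h0 : @unit_disk R (0, 0) by rewrite /unit_disk /= expr0n addr0 ltr01.
have [_ /(_ v)[_ ->]] := grad_strip _ h0.
rewrite /g1 /g2 /n1 /n2 /den /rho /xi /= /c.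
have -> : (1 - (0 ^+ 2 + 0 ^+ 2)) = 1 :> R by ring.
have -> : 1 ^+ 2 + 4 * (a * 0 + b * 0) ^+ 2 = 1 :> R by ring.
by rewrite !divr1; ring.
Qed.

End StripMap.

(** * Lower bounds for M *)

Section Boost.
Context {R : realType} {H : normedModType R} (dot : {dot H for idfun}).
Hypothesis norm_dot : forall x : H, `|x| ^+ 2 = dot x x.
Implicit Types (F : R * R -> H) (e : H) (K s : R).

(** [max_stretch_le] bounds the set of stretches, so its supremum is genuine. *)
Lemma M_ge_stretch K F : 0 < K -> admissible K F -> max_stretch F <= M H K.
Proof.
move=> K0 aF; apply: ub_le_sup; last by exists F.
exists (tau_objective K 0) => _ [G aG <-].
exact: (max_stretch_le dot norm_dot).
Qed.

Lemma line_linear e : linear (fun c : R => c *: e).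
Proof. by move=> a x y; rewrite /= scalerDl scalerA. Qed.

Definition line e : {linear R -> H} :=
  HB.pack (fun c : R => c *: e) (GRing.isLinear.Build _ _ _ _ _ (line_linear e)).

Lemma continuous_line e : continuous (line e).
Proof. exact: scalel_continuous. Qed.

Lemma homothety_linear s : linear (fun x : H => s *: x).
Proof. by move=> a x y; rewrite scalerDr !scalerA mulrC. Qed.

Definition homothety s : {linear H -> H} :=
  HB.pack (fun x : H => s *: x) (GRing.isLinear.Build _ _ _ _ _ (homothety_linear s)).

Lemma continuous_homothety s : continuous (homothety s).
Proof. exact: scaler_continuous. Qed.

(** The convex combination of F and of the strip map along the direction of
    greatest stretch has differential m A v at v and (1 - s) A w at w: these
    images are still orthogonal, and the ratio of the stretches has grown. *)
Lemma boost K1 K2 F s : 0 < K1 -> 0 < K2 -> admissible K1 F -> 0 <= s < 1 ->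
  (1 - s) * max_stretch F + s * (4 / pi) <= K2 * ((1 - s) * (max_stretch F / K1)) ->
  (1 - s) * max_stretch F + s * (4 / pi) <= M H K2.
Proof.
move=> K10 K20 aF /andP[s0 s1] hK.
have [phi [orth le maxE minE]] := exists_stretch_frame dot norm_dot F.
case: aF => hF F1 F0 [l0 /andP[lL LK]].
pose A := 'd F (0, 0).
rewrite -/A in orth le maxE minE.
set L := max_stretch F in hK lL LK maxE *; set l := min_stretch F in l0 lL LK minE.
have L0 : 0 < L by exact: lt_le_trans lL.
have s1' : 0 < 1 - s by rewrite subr_gt0.
have pi4 : 0 <= 4 / pi :> R by rewrite divr_ge0 // pi_ge0.
have sp : 0 <= s * (4 / pi) by exact: mulr_ge0.
pose e := L^-1 *: A (vdir phi).
have ne : `|e| = 1.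
  by rewrite normrZ -maxE ger0_norm ?invr_ge0 ?(ltW L0) // mulVf // gt_eqF.
pose u := strip (cos phi) (sin phi).
have hu : harmonic_on_disk u by exact: strip_harmonic (cos2Dsin2 phi).
pose G := fun p => homothety (1 - s) (F p) + line (s *: e) (u p).
have hG1 : harmonic_on_disk (fun p => homothety (1 - s) (F p)).
  exact: harmonic_lin (continuous_homothety _) _ hF.
have hG2 : harmonic_on_disk (fun p => line (s *: e) (u p)).
  exact: harmonic_lin (continuous_line _) _ hu.
have hG : harmonic_on_disk G by exact: harmonic_add.
have du : differentiable u (0, 0) by have [[/(_ _ disk0)[]]] := hu.
have dF := harmonic_differentiable0 F hF.
have dG := harmonic_differentiable0 G hG.
have AG v : 'd G (0, 0) v = (1 - s) *: A v + ('D_v u (0, 0) * s) *: e.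
  rewrite -deriveE // /G.
  have [[c1 _] _] := hG1; have [[c2 _] _] := hG2.
  rewrite (derive_add _ _ v _ c1 c2 disk0).
  rewrite (derive_lin _ (continuous_homothety _)) // (derive_lin _ (continuous_line _)) //=.
  by rewrite deriveE // scalerA.
pose m := (1 - s) + s * (4 / pi) / L.
have m0 : 0 <= m by rewrite addr_ge0 ?divr_ge0 // ltW.
have uv : 'D_(vdir phi) u (0, 0) = 4 / pi.
  rewrite derive_strip0.
  have -> : cos phi * (vdir phi).1 + sin phi * (vdir phi).2 = 1.
    by rewrite -(cos2Dsin2 phi) !expr2.
  by rewrite mulr1.
have uw : 'D_(wdir phi) u (0, 0) = 0.
  rewrite derive_strip0.
  have -> : cos phi * (wdir phi).1 + sin phi * (wdir phi).2 = 0.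
    by rewrite /wdir /=; ring.
  by rewrite mulr0.
have Av : 'd G (0, 0) (vdir phi) = m *: A (vdir phi).
  by rewrite AG uv /e scalerA -scalerDl /m [4 / pi * s]mulrC.
have Aw : 'd G (0, 0) (wdir phi) = (1 - s) *: A (wdir phi).
  by rewrite AG uw mul0r scale0r addr0.
have nv : `|'d G (0, 0) (vdir phi)| = (1 - s) * L + s * (4 / pi).
  rewrite Av normrZ ger0_norm // -maxE /m mulrDl; congr (_ + _).
  by rewrite divfK // gt_eqF.
have nw : `|'d G (0, 0) (wdir phi)| = (1 - s) * l.
  by rewrite Aw normrZ ger0_norm ?(ltW s1') // -minE.
have orthG : dot ('d G (0, 0) (vdir phi)) ('d G (0, 0) (wdir phi)) = 0.
  by rewrite Av Aw dotZl dotZr orth !mulr0.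
have leG : `|'d G (0, 0) (wdir phi)| <= `|'d G (0, 0) (vdir phi)|.
  by rewrite nv nw; apply: ler_wpDr => //; rewrite ler_pM2l.
have maxG : max_stretch G = (1 - s) * L + s * (4 / pi).
  by rewrite -nv; exact: (max_norm_conjugate dot norm_dot _ phi orthG leG).
have minG : min_stretch G = (1 - s) * l.
  by rewrite -nw; exact: (min_norm_conjugate dot norm_dot _ phi orthG leG).
rewrite -maxG; apply: (M_ge_stretch _ _ K20); split; first exact: hG.
- move=> p hp; rewrite /G /=; apply: le_lt_trans (ler_normD _ _) _.
  have -> : `|(1 - s) *: F p| = (1 - s) * `|F p|.
    by rewrite normrZ ger0_norm // ltW.
  have -> : `|u p *: (s *: e)| = `|u p| * s.
    by rewrite (normrZ (u p)) (normrZ s) ne mulr1 (ger0_norm s0).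
  have h1 : (1 - s) * `|F p| < 1 - s by rewrite -[ltRHS]mulr1 ltr_pM2l // F1.
  have h2 : `|u p| * s <= s by rewrite ler_piMl // ltW // strip_lt1.
  by rewrite -[ltRHS](subrK s); exact: ltr_leD.
- by rewrite /G F0 /u strip0 /= scale0r addr0 scaler0.
- rewrite minG; split; first exact: mulr_gt0.
  apply/andP; split.
    by rewrite maxG; apply: ler_wpDr => //; rewrite ler_pM2l.
  rewrite maxG; apply: (le_trans hK); rewrite ler_pM2l // ler_pM2l //.
  by rewrite ler_pdivrMr // mulrC.
Qed.

End Boost.

(** * The isometric embedding of the plane *)

Section Identity.
Context {R : realType} {H : normedModType R} (dot : {dot H for idfun}).
Hypothesis norm_dot : forall x : H, `|x| ^+ 2 = dot x x.

Lemma exists_orthonormal_pair :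
  (exists x y : H, forall a b : R, a *: x + b *: y = 0 -> a = 0 /\ b = 0) ->
  exists e f : H, [/\ `|e| = 1, `|f| = 1 & dot e f = 0].
Proof.
move=> [x [y ind]].
have unit (z : H) : z != 0 -> `| `|z|^-1 *: z| = 1.
  by move=> z0; rewrite normrZ normfV normr_id mulVf // normr_eq0.
have x0 : x != 0.
  apply/eqP => x0; have [] := ind 1 0; rewrite ?x0 ?scaler0 ?scale0r ?addr0 //.
  by move/eqP; rewrite oner_eq0.
pose e := `|x|^-1 *: x; pose z := y - dot y e *: e.
have z0 : z != 0.
  apply/eqP => z0; have [] := ind (- (dot y e * `|x|^-1)) 1.
    by rewrite scale1r scaleNr addrC -z0 /z /e scalerA.
  by move=> _ /eqP; rewrite oner_eq0.
have ee : dot e e = 1 by rewrite -norm_dot unit // expr1n.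
exists e, (`|z|^-1 *: z); split; [exact: unit|exact: unit|].
suff ez : dot e z = 0 by rewrite dotZr ez mulr0.
by rewrite /z -scaleNr dotDr dotZr ee mulr1 (dotC dot e y) subrr.
Qed.

Lemma fst_harmonic : harmonic_on_disk (fun p : R * R => p.1).
Proof.
apply: (@harmonic_criterion _ _ (fun=> 1) (fun=> 0) (fun=> 0) (fun=> 0) (fun=> 0) (fun=> 0)).
- move=> p _; split; first exact: df_fst.
  by move=> v; rewrite mulr1 mulr0 addr0; exact: is_derive_fst.
- by move=> p _; split=> [|v]; [exact: df_cst|rewrite !mulr0 addr0; exact: is_derive_cst].
- by move=> p _; split=> [|v]; [exact: df_cst|rewrite !mulr0 addr0; exact: is_derive_cst].
- by move=> p _; split; exact: cvg_cst.
- by move=> p _; rewrite addr0.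
Qed.

Lemma snd_harmonic : harmonic_on_disk (fun p : R * R => p.2).
Proof.
apply: (@harmonic_criterion _ _ (fun=> 0) (fun=> 1) (fun=> 0) (fun=> 0) (fun=> 0) (fun=> 0)).
- move=> p _; split; first exact: df_snd.
  by move=> v; rewrite mulr1 mulr0 add0r; exact: is_derive_snd.
- by move=> p _; split=> [|v]; [exact: df_cst|rewrite !mulr0 addr0; exact: is_derive_cst].
- by move=> p _; split=> [|v]; [exact: df_cst|rewrite !mulr0 addr0; exact: is_derive_cst].
- by move=> p _; split; exact: cvg_cst.
- by move=> p _; rewrite addr0.
Qed.

Lemma isometry_admissible (e f : H) : `|e| = 1 -> `|f| = 1 -> dot e f = 0 ->
  exists F : R * R -> H, admissible 1 F /\ max_stretch F = 1.
Proof.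
move=> e1 f1 ef; pose F := fun p : R * R => line e p.1 + line f p.2.
have h1 : harmonic_on_disk (fun p : R * R => line e p.1).
  exact: harmonic_lin (continuous_line e) _ fst_harmonic.
have h2 : harmonic_on_disk (fun p : R * R => line f p.2).
  exact: harmonic_lin (continuous_line f) _ snd_harmonic.
have hF : harmonic_on_disk F by exact: harmonic_add.
have dF := harmonic_differentiable0 F hF.
have AF v : 'd F (0, 0) v = v.1 *: e + v.2 *: f.
  rewrite -deriveE // /F.
  have [[c1 _] _] := h1; have [[c2 _] _] := h2.
  rewrite (derive_add _ _ v _ c1 c2 disk0).
  rewrite (derive_lin _ (continuous_line e) _ v _ (df_fst _)).
  rewrite (derive_lin _ (continuous_line f) _ v _ (df_snd _)) /=.
  have [_ ->] := is_derive_fst (0, 0) v.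
  by have [_ ->] := is_derive_snd (0, 0) v.
have Av : 'd F (0, 0) (vdir 0) = e.
  by rewrite AF /vdir cos0 sin0 /= scale1r scale0r addr0.
have Aw : 'd F (0, 0) (wdir 0) = f.
  by rewrite AF /wdir cos0 sin0 /= oppr0 scale1r scale0r add0r.
have orth : dot ('d F (0, 0) (vdir 0)) ('d F (0, 0) (wdir 0)) = 0 by rewrite Av Aw.
have le : `|'d F (0, 0) (wdir 0)| <= `|'d F (0, 0) (vdir 0)| by rewrite Av Aw e1 f1.
have maxE : max_stretch F = 1.
  by rewrite -e1 -Av; exact: (max_norm_conjugate dot norm_dot _ 0 orth le).
have minE : min_stretch F = 1.
  by rewrite -f1 -Aw; exact: (min_norm_conjugate dot norm_dot _ 0 orth le).
exists F; split => //; split; first exact: hF.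
- move=> p hp; rewrite -ltr_sqr ?nnegrE // expr1n /F /=.
  by rewrite (norm_comb2 dot norm_dot) e1 f1 ef expr1n !mulr1 mulr0 addr0.
- by rewrite /F /= !scale0r addr0.
- by rewrite maxE minE mulr1 ltr01 !lexx.
Qed.

Lemma admissible_mono (K1 K2 : R) (F : R * R -> H) :
  K1 <= K2 -> admissible K1 F -> admissible K2 F.
Proof.
move=> K12 [hF F1 F0 [l0 /andP[lL LK]]]; split => //; split => //.
by rewrite lL (le_trans LK) // ler_wpM2r // ltW.
Qed.

End Identity.

(** * The bounds for M and its monotonicity *)

Section MonotoneRadius.
Context {R : realType} {H : normedModType R} (dot : {dot H for idfun}).
Hypothesis norm_dot : forall x : H, `|x| ^+ 2 = dot x x.
Hypothesis dim_ge2 : exists x y : H,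
  forall a b : R, a *: x + b *: y = 0 -> a = 0 /\ b = 0.
Implicit Types K : R.

Lemma exists_admissible K : 1 <= K ->
  exists F : R * R -> H, admissible K F /\ max_stretch F = 1.
Proof.
move=> K1; have [e [f [e1 f1 ef]]] := exists_orthonormal_pair dot norm_dot dim_ge2.
have [F [aF mF]] := isometry_admissible dot norm_dot e f e1 f1 ef.
by exists F; split => //; exact: admissible_mono aF.
Qed.

Lemma M_le_objective K t : 1 <= K -> 0 <= t -> M H K <= tau_objective K t.
Proof.
move=> K1 t0; have K0 : 0 < K by lra.
have [F [aF _]] := exists_admissible K K1.
apply: sup_le_ub; first by exists (max_stretch F), F.
by move=> _ [G aG <-]; exact: (max_stretch_le dot norm_dot).
Qed.

Lemma four_div_pi_gt1 : 1 < 4 / pi :> R.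
Proof. by rewrite ltr_pdivlMr ?pi_gt0 // mul1r; have := @pihalf_lt2 R; lra. Qed.

Lemma M_lt_four_div_pi K : 1 <= K -> M H K < 4 / pi.
Proof.
move=> K1; have K0 : 0 < K by lra.
have [t [/andP[t0 _] h]] := obj_slope K K0.
apply: le_lt_trans (M_le_objective K t K1 (ltW t0)) (lt_le_trans h _).
by rewrite /tau_objective J0 mul0r addr0 divr1 mulrA -natrM.
Qed.

Lemma M_lt_rms K : 1 < K -> M H K < 2 * K / (K + 1).
Proof.
move=> K1; apply: le_lt_trans (M_le_objective K K^-1 (ltW K1) _) (obj_invK_lt K K1).
by rewrite invr_ge0; lra.
Qed.

(** The weight s in [boost] is the one for which the stretches of the combined
    map have ratio exactly K2 when those of F have ratio K1. *)
Lemma stretch_propagation K1 K2 (F : R * R -> H) : 0 < K1 -> K1 <= K2 ->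
  admissible K1 F ->
  K2 / K1 * (4 / pi) * max_stretch F
  <= M H K2 * (4 / pi + (K2 / K1 - 1) * max_stretch F).
Proof.
move=> K10 K12 aF; set c := 4 / pi; set k := K2 / K1; have K20 : 0 < K2 by lra.
have L0 : 0 < max_stretch F.
  by case: aF => _ _ _ [l0 /andP[lL _]]; exact: lt_le_trans lL.
have c0 : 0 < c by exact: lt_trans four_div_pi_gt1.
have k1 : 0 <= k - 1 by rewrite subr_ge0 /k ler_pdivlMr // mul1r.
set L := max_stretch F in L0 *.
have kL : 0 <= (k - 1) * L by rewrite mulr_ge0 // ltW.
have D0 : 0 < c + (k - 1) * L by rewrite ltr_wpDr.
pose s := (k - 1) * L / (c + (k - 1) * L).
have s01 : 0 <= s < 1.
  by rewrite divr_ge0 ?(ltW D0) //= ltr_pdivrMr // mul1r ltrDr.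
have E : (1 - s) * L + s * c = k * c * L / (c + (k - 1) * L).
  by rewrite /s; field; rewrite gt_eqF.
have E2 : K2 * ((1 - s) * (L / K1)) = k * c * L / (c + (k - 1) * L).
  rewrite (_ : K2 * ((1 - s) * (L / K1)) = k * (1 - s) * L); last first.
    by rewrite /k; move: s {s01 E} => s; field; rewrite gt_eqF.
  by rewrite /s; field; rewrite gt_eqF.
have := boost dot norm_dot K1 K2 F s K10 K20 aF s01; rewrite -/L -/c E E2 => /(_ (lexx _)).
by rewrite ler_pdivrMr.
Qed.

Lemma M_lower_bound K : 1 <= K -> 4 / pi * K / (K - 1 + 4 / pi) <= M H K.
Proof.
move=> K1; have [F [aF mF]] := exists_admissible 1 (lexx 1).
have c0 : 0 < 4 / pi :> R by exact: lt_trans four_div_pi_gt1.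
have := stretch_propagation 1 K F ltr01 K1 aF; rewrite mF divr1 !mulr1 => h.
rewrite ler_pdivrMr; last by rewrite ltr_wpDl // subr_ge0.
by rewrite mulrC [_ - 1 + _]addrC.
Qed.

Lemma M1 : M H 1 = 1.
Proof.
apply/eqP; rewrite eq_le; apply/andP; split.
  by have := M_le_objective 1 1 (lexx 1) ler01; rewrite obj1 // mulr1 mulfV.
have := M_lower_bound 1 (lexx 1); rewrite subrr add0r mulr1 mulfV //.
by rewrite gt_eqF // (lt_trans _ four_div_pi_gt1).
Qed.

Lemma M_gt1 K : 1 < K -> 1 < M H K.
Proof.
move=> K1; apply: lt_le_trans (M_lower_bound K (ltW K1)).
have := four_div_pi_gt1; move: (4 / pi) => c c1.
by rewrite ltr_pdivlMr; nra.
Qed.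

Lemma M_increasing K1 K2 : 1 <= K1 -> K1 < K2 -> M H K1 < M H K2.
Proof.
move=> h1 h2; have K10 : 0 < K1 by lra.
have M2c := M_lt_four_div_pi K2 (ltW (le_lt_trans h1 h2)).
have M20 : 0 < M H K2 by apply: lt_trans (M_gt1 K2 (le_lt_trans h1 h2)).
have k1 : 1 < K2 / K1 by rewrite ltr_pdivlMr // mul1r.
have prop F := stretch_propagation K1 K2 F K10 (ltW h2).
have c1 := four_div_pi_gt1.
move: (4 / pi) (K2 / K1) (M H K2) M2c M20 k1 prop c1 => c k m mc m0 k1 prop c1.
(* [prop] solved for the stretch of F bounds it by
   m c / (k c - (k - 1) m), and m < c makes this bound smaller than m. *)
have D : c < k * c - (k - 1) * m by nra.
have D0 : 0 < k * c - (k - 1) * m by lra.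
apply: (@le_lt_trans _ _ (m * c / (k * c - (k - 1) * m))); last first.
  by rewrite ltr_pdivrMr // ltr_pM2l.
have [F0 [aF0 _]] := exists_admissible K1 h1.
apply: sup_le_ub; first by exists (max_stretch F0), F0.
move=> _ [F aF <-]; rewrite ler_pdivlMr //.
by have := prop F aF => /=; lra.
Qed.

Lemma M_cvg : M H K @[K --> +oo] --> 4 / pi.
Proof.
apply/cvgrPdist_le => eps eps0.
have c1 := four_div_pi_gt1.
near=> K.
have K1 : 1 <= K by near: K; exact: nbhs_pinfty_ge.
have lo := M_lower_bound K K1; have up := M_lt_four_div_pi K K1.
rewrite ger0_norm; last by rewrite subr_ge0 ltW.
have big : (4 / pi) ^+ 2 / eps <= K by near: K; apply: nbhs_pinfty_ge; rewrite num_real.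
move: (4 / pi) (M H K) c1 lo up big => c m c1 lo up; rewrite ler_pdivrMr // => big.
apply: (@le_trans _ _ (c - c * K / (K - 1 + c))); first by rewrite lerD2l lerN2.
rewrite lerBlDl -lerBlDr.
rewrite ler_pdivlMr; last by lra.
have e1 : 0 <= eps * (c - 1) by apply: mulr_ge0; [exact: ltW|lra].
nra.
Unshelve. all: by end_near. Qed.

End MonotoneRadius.

Theorem corollary8p5 (R : realType) (H : completeNormedModType R)
    (dot : {dot H for idfun})
    (norm_dot : forall x : H, `|x| ^+ 2 = dot x x)
    (dim_ge2 : exists x y : H,
        forall a b : R, a *: x + b *: y = 0 -> a = 0 /\ b = 0) :
  (forall K1 K2 : R, 1 <= K1 -> K1 < K2 -> tau K2 < tau K1) /\
  (forall K1 K2 : R, 1 <= K1 -> K1 < K2 -> M H K1 < M H K2) /\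
  M H 1 = 1 /\
  (forall K : R, 1 < K ->
     1 < M H K /\ M H K < Num.min (2 * K / (K + 1)) (4 / pi)) /\
  M H K @[K --> +oo] --> 4 / pi.
Proof.
split; first exact: tau_decreasing.
split; first exact: (M_increasing dot norm_dot dim_ge2).
split; first exact: (M1 dot norm_dot dim_ge2).
split; last exact: (M_cvg dot norm_dot dim_ge2).
move=> K K1; split; first exact: (M_gt1 dot norm_dot dim_ge2).
rewrite lt_min (M_lt_rms dot norm_dot dim_ge2) //.
by rewrite (M_lt_four_div_pi dot norm_dot dim_ge2) // ltW.
Qed.
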